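(* (a) Assume that: - there is a continuous $\rho:I\to[0,+\infty)$ with $|D_kq_{ij}(t,x)|\le\rho(t)\eta(t,x)$ for all $i,j,k\in\{1,\dots,d\}$, $(t,x)\in I\times\mathbb{R}^d$; - there exist a function $r:I\times\mathbb{R}^d\to\mathbb{R}$ and a constant $p_0\in(1,+\infty)$ such that $\langle\nabla_xb(t,x)\xi,\xi\rangle\le r(t,x)|\xi|^2$ for all $\xi\in\mathbb{R}^d$, $(t,x)\in I\times\mathbb{R}^d$, and $$\sup_{(t,x)\in I\times\mathbb{R}^d}\left(r(t,x)+\frac{d^3(\rho(t))^2\eta(t,x)}{4\min\{p_0-1,1\}}\right)<+\infty.$$ Then, for every $p\ge p_0$ and every $f\in C^1_b(\mathbb{R}^d)$, $$|(\nabla G(t,s)f)(x)|^p\le e^{\sigma_p(t-s)}(G(t,s)|\nabla f|^p)(x),\qquad t\ge s,\ s,t\in I,\ x\in\mathbb{R}^d,\qquad( * )$$ where $$\sigma_p=p\sup_{(t,x)\in I\times\mathbb{R}^d}\left(r(t,x)+\frac{d^3(\rho(t))^2\eta(t,x)}{4\min\{p_0-1,1\}}\right).$$ (b) Assume instead that there exist a real constant $k_0$ with $\langle\nabla_xb(t,x)\xi,\xi\rangle\le k_0|\xi|^2$ for all $\xi\in\mathbb{R}^d$, $(t,x)\in I\times\mathbb{R}^d$, and a positive constant $\rho_0$ with $|D_kq_{ij}(t,x)|\le\rho_0(\eta(t,x))^{1/2}$ for all $i,j,k\in\{1,\dots,d\}$, $(t,x)\in I\times\mathbb{R}^d$. Then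 $( * )$ holds for every $p\in(1,+\infty)$ and every $f\in C^1_b(\mathbb{R}^d)$, with $$\sigma_p=p\left(k_0+\frac{d^3\rho_0^2}{4\min\{p-1,1\}}\right).$$ (c) If, in addition to the assumptions of (b), the coefficients $q_{ij}$ $(i,j=1,\dots,d)$ do not depend on $x$ and $r\le\eta$ in $I\times\mathbb{R}^d$ for a function $r:I\times\mathbb{R}^d\to\mathbb{R}$ satisfying $\langle\nabla_xb(t,x)\xi,\xi\rangle\le r(t,x)|\xi|^2$ for all $\xi\in\mathbb{R}^d$, $(t,x)\in I\times\mathbb{R}^d$, then $( * )$ holds also for $p=1$, with $\sigma_1=k_0$, for every $f\in C^1_b(\mathbb{R}^d)$.
   Context: $d\ge 1$ is an integer and $I\subset\mathbb{R}$ is an interval which is either $\mathbb{R}$ or a right halfline. For $t\in I$ and smooth $\varphi:\mathbb{R}^d\to\mathbb{R}$, $$(\mathcal{A}(t)\varphi)(x)=\sum_{i,j=1}^d q_{ij}(t,x)D_{ij}\varphi(x)+\sum_{i=1}^d b_i(t,x)D_i\varphi(x),$$ with $Q=(q_{ij})$, $b=(b_i)$; $\nabla_xb$ is the Jacobian matrix of $b(t,\cdot)$. $C^{\alpha/2,\alpha}_{\rm loc}(I\times\mathbb{R}^d)$ is the set of functions that are $\alpha$-Hölder continuous with respect to the parabolic distance on every compact subset of $I\times\mathbb{R}^d$. Assumed in all parts, for some $\alpha\in(0,1)$: (1) all $q_{ij},b_i$ and their first-order spatial derivatives belong to $C^{\alpha/2,\alpha}_{\rm loc}(I\times\mathbb{R}^d)$;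 (2) for every $(t,x)\in I\times\mathbb{R}^d$ the matrix $Q(t,x)$ is symmetric, and there is a function $\eta:I\times\mathbb{R}^d\to\mathbb{R}$ with $0<\eta_0:=\inf_{I\times\mathbb{R}^d}\eta$ and $\langle Q(t,x)\xi,\xi\rangle\ge\eta(t,x)|\xi|^2$ for all $\xi\in\mathbb{R}^d$, $(t,x)\in I\times\mathbb{R}^d$ (this $\eta$ is the one appearing in the claim); (3) for every bounded interval $J\subset I$ there exist $\varphi=\varphi_J\in C^2(\mathbb{R}^d)$ and $\lambda=\lambda_J>0$ such that $\lim_{|x|\to+\infty}\varphi(x)=+\infty$ and $(\mathcal{A}(t)\varphi)(x)-\lambda\varphi(x)\le0$ for $(t,x)\in J\times\mathbb{R}^d$. Under these assumptions, for every $s\in I$ and $f\in C_b(\mathbb{R}^d)$ (bounded continuous functions) there is a unique bounded classical solution $u_f\in C_b([s,+\infty)\times\mathbb{R}^d)\cap C^{1,2}((s,+\infty)\times\mathbb{R}^d)$ of $u_t=\mathcal{A}(t)u$ in $(s,+\infty)\times\mathbb{R}^d$, $u(s,\cdot)=f$; for $t>s$, $(G(t,s)f)(x)=u_f(t,x)$, and $G(t,t)=\mathrm{id}$. $C^1_b(\mathbb{R}^d)$ is the space of bounded $C^1$ functions with bounded first derivatives. *)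

(* Defs.v *)
From mathcomp Require Import all_boot all_order all_algebra.
From mathcomp Require Import all_classical all_reals all_analysis.
Import Order.TTheory GRing.Theory Num.Theory.
Import numFieldNormedType.Exports.

Set Implicit Arguments.
Unset Strict Implicit.
Unset Printing Implicit Defensive.

Local Open Scope classical_set_scope.
Local Open Scope ring_scope.

Section Defs.
Variables (R : realType) (d : nat).

(* Points of R^d are row vectors. The library norm on 'rV[R]_d is the sup norm
   (it induces the same topology), hence a separate Euclidean norm. *)
Definition dot (x y : 'rV[R]_d) : R := \sum_i x 0 i * y 0 i.
Definition enorm (x : 'rV[R]_d) : R := Num.sqrt (dot x x).

(* <A xi, xi>, where A acts on column vectors. *)
Definition qform (A : 'M[R]_d) (xi : 'rV[R]_d) : R := dot (xi *m A^T) xi.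

Definition unit_vec (i : 'I_d) : 'rV[R]_d := delta_mx 0 i.
Definition pder (i : 'I_d) (f : 'rV[R]_d -> R) : 'rV[R]_d -> R :=
  'D_(unit_vec i) f.
Definition grad (f : 'rV[R]_d -> R) (x : 'rV[R]_d) : 'rV[R]_d :=
  \row_i pder i f x.
Definition jac (g : 'rV[R]_d -> 'rV[R]_d) (x : 'rV[R]_d) : 'M[R]_d :=
  \matrix_(i, j) pder j (fun y => g y 0 i) x.

Definition C1 (f : 'rV[R]_d -> R) : Prop :=
  continuous f /\
  forall i, (forall x, derivable f x (unit_vec i)) /\ continuous (pder i f).
Definition C2 (f : 'rV[R]_d -> R) : Prop :=
  C1 f /\ forall i, C1 (pder i f).
Definition Cb (f : 'rV[R]_d -> R) : Prop := continuous f /\ bounded_fun f.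
Definition C1b (f : 'rV[R]_d -> R) : Prop :=
  [/\ C1 f, bounded_fun f & forall i, bounded_fun (pder i f)].

Definition R_or_right_halfline (I : set R) : Prop :=
  I = setT \/ exists a : R, I = `]a, +oo[%classic \/ I = `[a, +oo[%classic.

Definition pardist (z w : R * 'rV[R]_d) : R :=
  enorm (z.2 - w.2) + Num.sqrt `|z.1 - w.1|.

(* C^{alpha/2,alpha}_loc (I x R^d) *)
Definition holder_loc (I : set R) (alpha : R) (f : R -> 'rV[R]_d -> R) : Prop :=
  forall K : set (R * 'rV[R]_d), compact K -> K `<=` I `*` setT ->
  exists C, forall z w, K z -> K w ->
    `|f z.1 z.2 - f w.1 w.2| <= C * pardist z w `^ alpha.

Definition holder1_loc (I : set R) (alpha : R) (f : R -> 'rV[R]_d -> R) : Prop :=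
  holder_loc I alpha f /\
  forall k, (forall t x, I t -> derivable (f t) x (unit_vec k)) /\
            holder_loc I alpha (fun t => pder k (f t)).

Section Operator.
Variables (q : R -> 'rV[R]_d -> 'M[R]_d) (b : R -> 'rV[R]_d -> 'rV[R]_d).

Definition opA (t : R) (phi : 'rV[R]_d -> R) (x : 'rV[R]_d) : R :=
  \sum_i \sum_j q t x i j * pder i (pder j phi) x
  + \sum_i b t x 0 i * pder i phi x.

Definition regular_coefficients (I : set R) (alpha : R) : Prop :=
  (forall i j, holder1_loc I alpha (fun t x => q t x i j)) /\
  (forall i, holder1_loc I alpha (fun t x => b t x 0 i)).

(* As inf takes the value 0 on sets that have no lower bound, the second clause
   does express that eta is bounded away from 0. *)
Definition uniformly_elliptic (I : set R) (eta : R -> 'rV[R]_d -> R) : Prop :=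
  [/\ forall t x, I t -> (q t x)^T = q t x,
      0 < inf [set eta z.1 z.2 | z in I `*` setT] &
      forall t x xi, I t -> eta t x * enorm xi ^+ 2 <= qform (q t x) xi].

Definition has_lyapunov (I : set R) : Prop :=
  forall J : set R, is_interval J -> bounded_set J -> J `<=` I ->
  exists (phi : 'rV[R]_d -> R) (lambda : R),
    [/\ C2 phi, 0 < lambda,
        forall M, exists rad, forall x, rad < enorm x -> M < phi x &
        forall t x, J t -> opA t phi x - lambda * phi x <= 0].

(* C^{1,2}((s,+oo) x R^d) *)
Definition C12 (s : R) (u : R -> 'rV[R]_d -> R) : Prop :=
  [/\ forall t x, s < t ->
        [/\ derivable (u^~ x) t 1,
            forall i, derivable (u t) x (unit_vec i) &
            forall i j, derivable (pder j (u t)) x (unit_vec i)],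
      forall z, s < z.1 -> {for z, continuous (fun z => derive1 (u^~ z.2) z.1)},
      forall z i, s < z.1 ->
        {for z, continuous (fun z => pder i (u z.1) z.2)} &
      forall z i j, s < z.1 ->
        {for z, continuous (fun z => pder i (pder j (u z.1)) z.2)}].

Definition bounded_classical_solution (s : R) (f : 'rV[R]_d -> R)
    (u : R -> 'rV[R]_d -> R) : Prop :=
  let D := [set z : R * 'rV[R]_d | s <= z.1] in
  [/\ {within D, continuous (fun z => u z.1 z.2)},
      [bounded u z.1 z.2 | z in D],
      C12 s u,
      forall t x, s < t -> derive1 (u^~ x) t = opA t (u t) x &
      forall x, u s x = f x].

(* G t s f stands for G(t,s)f; it is constrained only for t >= s, s in I and
   f in C_b(R^d). Uniqueness of the bounded classical solution is a consequence
   of has_lyapunov and is not part of the definition. *)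
Definition evolution_operator (I : set R)
    (G : R -> R -> ('rV[R]_d -> R) -> 'rV[R]_d -> R) : Prop :=
  forall s f, I s -> Cb f ->
    bounded_classical_solution s f (fun t => G t s f).

End Operator.

Definition jac_bounded_by (I : set R) (b : R -> 'rV[R]_d -> 'rV[R]_d)
    (r : R -> 'rV[R]_d -> R) : Prop :=
  forall t x xi, I t -> qform (jac (b t) x) xi <= r t x * enorm xi ^+ 2.

Definition gradient_estimate (I : set R)
    (G : R -> R -> ('rV[R]_d -> R) -> 'rV[R]_d -> R)
    (p sigma : R) (f : 'rV[R]_d -> R) : Prop :=
  forall s t x, I s -> I t -> s <= t ->
    enorm (grad (G t s f) x) `^ p <=
    expR (sigma * (t - s)) * G t s (fun y => enorm (grad f y) `^ p) x.

End Defs.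

(* Main.v *)
(* The gradient is estimated without differentiating the equation, by a maximum
   principle in two space variables. Let q >= 2 and suppose that
   grad f(x).h <= psi(x) + beta |h|^q for all x, h. One compares u(t,y) - u(t,x)
   with e (G(t,s)psi)(x) + e^(1-q) beta exp(q kappa (t-s)) |y-x|^q, plus a small
   multiple of the Lyapunov function; let B(t,x) collect u(t,x) and the terms
   that do not involve y. At a positive interior maximum of the difference,
   y <> x, and the second order conditions bound <D2u(y) ze, ze> by
   <D2B(x) xi, xi> + c |ze - xi|^2 for all ze, xi. The
   Hopf-Lax family A_theta = A (1 + theta A / c)^-1 turns this into a bound of
   tr(Q(y) D2u(y)) - tr(Q(x) D2B(x)): differentiating tr(A_theta Q) along the
   segment from x to y costs c |Q'|^2 / (4 eta), which is where the term
   d^3 rho^2 eta / 4 comes from, and |y-x|^q with q - 1 = 1 / min(p-1,1)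
   yields the exact constant. Letting e -> 0 gives
   grad u(t,x).h <= (G(t,s)psi)(x) + beta exp(q kappa (t-s)) |h|^q,
   and psi = |grad f|^p with Young's inequality gives the estimate for p <= 2.
   For p > 2 it follows from the one for 2 by convexity, and for p = 1 from
   the limit p -> 1. *)
Require Import Defs.
From mathcomp Require Import all_boot all_order all_algebra.
From mathcomp Require Import all_classical all_reals all_analysis.
From mathcomp Require Import ring lra.
Import Order.TTheory GRing.Theory Num.Theory.
Import numFieldNormedType.Exports.
Set Implicit Arguments.
Unset Strict Implicit.
Unset Printing Implicit Defensive.
Local Open Scope classical_set_scope.
Local Open Scope ring_scope.

(** * Lines and one-dimensional maximum tests *)

(** A Bernstein argument would apply the parabolic operator to |grad u|^p; it involves third
    derivatives of [u] and control of grad u at infinity, whereas [C12] and boundedness give two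
    space derivatives and bounded values. This is why values at two points are compared. Young's
    inequality is what makes the right side linear: for fixed h the bound on grad f . h is affine in
    psi, so psi can be evolved by [G] itself. The weight e^(1-q) comes from y = x + e h, which turns
    the penalty into e |h|^q, of the same order e as the increment of u. The constant is read off
    the penalty |y-x|^q: its gradient is q |y-x|^(q-2) (y-x) and its Hessian is at most q (q-1)
    |y-x|^(q-2). With |D_k q_ij|^2 <= m eta, drift and diffusion contribute at most q (r + (q-1) d^3
    m / 4) times the penalty, and kappa bounds the bracket. This Hessian bound is for q >= 2, that
    is p <= 2, where q - 1 = 1 / (p-1); hence the minimum of p - 1 and 1. *)

Section Lines.
Context {R : realType} {d : nat}.
Implicit Types (f : 'rV[R]_d -> R) (x v w : 'rV[R]_d).

Lemma is_derive_line f x v (s l : R) :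
  is_derive (x + s *: v) v f l <-> is_derive s 1 (fun r => f (x + r *: v)) l.
Proof.
have E : (fun h : R => h^-1 *: ((f \o shift (x + s *: v)) (h *: v)
            - f (x + s *: v))) =
         (fun h : R => h^-1 *: (((fun r => f (x + r *: v)) \o shift s) (h *: 1)
            - f (x + s *: v))).
  apply/funext => h /=; congr (_ *: (f _ - _)).
  by rewrite /shift/= [h *: 1]mulr1 scalerDl addrCA.
split=> -[dfx <-]; apply: DeriveDef.
- by move: dfx; rewrite /derivable E.
- by rewrite /derive E.
- by rewrite /derivable E.
- by rewrite /derive E.
Qed.

Lemma is_derive_continuous (k : R -> R) (r l : R) :
  is_derive r 1 k l -> {for r, continuous k}.
Proof.
by move=> [dk _]; apply/differentiable_continuous/derivable1_diffP.
Qed.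

(** [C1] speaks of partial derivatives only; adding one coordinate at a time, this passes to
    arbitrary directions. The increment along [w] is a value of [g] at an intermediate point, by the
    mean value theorem, and that point tends to [x]. *)
Lemma is_derive_add_dir f (g : 'rV[R]_d -> R) x v w (l a : R) :
  is_derive x v f l -> (forall y, is_derive y w f (g y)) ->
  {for x, continuous g} -> is_derive x (v + a *: w) f (l + a * g x).
Proof.
move=> dv dw cg.
have mv (s : R) : exists tau : R, 0 <= tau <= 1 /\
  f (x + s *: v + (s * a) *: w) - f (x + s *: v) =
  s * a * g (x + s *: v + (tau * (s * a)) *: w).
  pose k (r : R) := f (x + s *: v + (r * (s * a)) *: w).
  have dk (r : R) :
      is_derive r 1 k (s * a * g (x + s *: v + (r * (s * a)) *: w)).
    have /is_derive_line H := dw (x + s *: v + (r * (s * a)) *: w).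
    rewrite mulrC.
    apply: (@is_derive1_comp R (fun t => f (x + s *: v + t *: w))
       (fun r => r * (s * a)) r) => //.
    by apply: is_derive_eq; rewrite scaler0 add0r [_ *: _]mulr1.
  have [|tau tau01 E] := @MVT_segment R k _ 0 1 ler01 (fun r _ => dk r).
    apply: continuous_subspaceT => r; exact: is_derive_continuous (dk r).
  exists tau; split; first by rewrite in_itv in tau01.
  by move: E; rewrite /k mul1r mul0r scale0r addr0 subr0 mulr1.
have [tau /all_and2 [tau01 Etau]] := choice mv.
(* [tau] comes from a choice and need not be continuous; its bounds suffice for the limit. *)
have ct : (tau s * s) @[s --> (0 : R)] --> (0 : R).
  apply/(@cvgrPdist_lt _ R^o) => e e0; near=> s; rewrite sub0r normrN.
  have /andP[? ?] := tau01 s.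
  have : `|s| < e by near: s; apply: (@nbhs0_lt _ R^o).
  by apply: le_lt_trans; rewrite normrM ler_piMl// ger0_norm.
have cz : (x + s *: v + (tau s * (s * a)) *: w) @[s --> (0 : R)] --> x.
  have E0 : x + 0 *: v + (0 * a) *: w = x by rewrite mul0r !scale0r !addr0.
  rewrite -[X in _ --> X]E0; apply: cvgD; first apply: cvgD.
  - exact: cvg_cst.
  - apply: cvgZr_tmp; exact: cvg_id.
  - by apply: cvgZr_tmp; under eq_fun do rewrite mulrA; exact: cvgMr_tmp.
have cq : (fun s : R => s^-1 *: (f (s *: v + x) - f x) +
     a * g (x + s *: v + (tau s * (s * a)) *: w)) @ 0^' --> l + a * g x.
  apply: cvgD.
    by case: dv => dv <-; exact: dv.
  apply: cvgMl_tmp; apply: cvg_within_filter.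
  exact: (cvg_comp _ _ cz cg).
suff cD : (s^-1 *: (f (s *: (v + a *: w) + x) - f x)) @[s --> (0 : R)^'] -->
    l + a * g x.
  by apply: DeriveDef; [apply/cvg_ex; exists (l + a * g x)|exact/cvg_lim].
apply: cvg_trans cq; apply: near_eq_cvg; near=> s.
have s0 : s != 0 by near: s; exact: nbhs_dnbhs_neq.
rewrite !scalerDr scalerA !(addrC _ x) !addrA.
have -> : f (x + s *: v + (s * a) *: w) = f (x + s *: v) +
   s * a * g (x + s *: v + (tau s * (s * a)) *: w).
  by have := Etau s; lra.
by rewrite /GRing.scale/=; field.
Unshelve. all: by end_near. Qed.

Lemma row_sum_unit_vec v : v = \sum_i v 0 i *: unit_vec R i.
Proof. exact: row_sum_delta. Qed.

Lemma C1_is_derive f x v : C1 f -> is_derive x v f (dot v (grad f x)).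
Proof.
move=> [_ pf].
have H (r : seq 'I_d) : is_derive x (\sum_(i <- r) v 0 i *: unit_vec R i) f
    (\sum_(i <- r) v 0 i * pder i f x).
  elim: r => [|i r IH]; first by rewrite !big_nil; exact: is_derive0.
  rewrite !big_cons addrC [X in is_derive _ _ _ X]addrC.
  apply: is_derive_add_dir IH _ _; last exact: (pf i).2.
  by move=> y; exact/derivableP/(pf i).1.
have := H (index_enum 'I_d); rewrite -row_sum_unit_vec.
by move/is_derive_eq; apply; apply: eq_bigr => i _; rewrite mxE.
Qed.

Lemma C1_line f x v (s : R) : C1 f ->
  is_derive s 1 (fun r : R => f (x + r *: v)) (dot v (grad f (x + s *: v))).
Proof. by move=> f1; apply/is_derive_line; exact: C1_is_derive. Qed.

Definition hess f x : 'M[R]_d := \matrix_(i, j) pder i (pder j f) x.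

Lemma C2_line f x v (s : R) : C2 f ->
  is_derive s 1 (fun r : R => dot v (grad f (x + r *: v)))
    (dot (v *m hess f (x + s *: v)) v).
Proof.
move=> [_ f2].
have -> : (fun r : R => dot v (grad f (x + r *: v))) =
    \sum_(i < d) (fun r : R => v 0 i * pder i f (x + r *: v)).
  by apply/funext => r; rewrite fct_sumE; apply: eq_bigr => i _; rewrite mxE.
apply: is_derive_eq.
  apply: is_derive_sum => i.
  by apply: is_deriveZ; apply: C1_line; exact: f2.
rewrite /dot; apply: eq_bigr => i _.
rewrite [_ *: _]mulrC mxE; congr (_ * _).
by apply: eq_bigr => j _; rewrite !mxE.
Qed.

End Lines.

(** * Euclidean inner product and norm *)

Section Dot.
Context {R : realType} {d : nat}.
Implicit Types (x y v w : 'rV[R]_d) (A B : 'M[R]_d).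

Lemma dotC x y : dot x y = dot y x.
Proof. by apply: eq_bigr => i _; rewrite mulrC. Qed.

Lemma dotDl x y v : dot (x + y) v = dot x v + dot y v.
Proof. by rewrite -big_split; apply: eq_bigr => i _; rewrite mxE mulrDl. Qed.

Lemma dotZl (a : R) x v : dot (a *: x) v = a * dot x v.
Proof. by rewrite mulr_sumr; apply: eq_bigr => i _; rewrite mxE mulrA. Qed.

Lemma dotDr x y v : dot v (x + y) = dot v x + dot v y.
Proof. by rewrite !(dotC v) dotDl. Qed.

Lemma dotZr (a : R) x v : dot v (a *: x) = a * dot v x.
Proof. by rewrite !(dotC v) dotZl. Qed.

Lemma dotNl x v : dot (- x) v = - dot x v.
Proof. by rewrite -scaleN1r dotZl mulN1r. Qed.

Lemma dotNr x v : dot v (- x) = - dot v x.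
Proof. by rewrite !(dotC v) dotNl. Qed.

Lemma dot0l v : dot 0 v = 0.
Proof. by rewrite -(scale0r 0) dotZl mul0r. Qed.

Lemma dot0r v : dot v 0 = 0.
Proof. by rewrite dotC dot0l. Qed.

Definition dotE := (dotDl, dotDr, dotZl, dotZr, dotNl, dotNr, dot0l, dot0r).

Lemma dot_ge0 x : 0 <= dot x x.
Proof. by apply: sumr_ge0 => i _; rewrite -expr2 sqr_ge0. Qed.

Lemma dot_eq0 x : (dot x x == 0) = (x == 0).
Proof.
apply/idP/idP => [/eqP x0|/eqP ->]; last by rewrite dot0l.
apply/eqP/rowP => i; rewrite mxE; apply/eqP; rewrite -sqrf_eq0 expr2; apply/eqP.
by apply: (psumr_eq0P _ x0) => // j _; rewrite -expr2 sqr_ge0.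
Qed.

Lemma dot_gt0 x : (0 < dot x x) = (x != 0).
Proof. by rewrite lt_neqAle dot_ge0 andbT eq_sym dot_eq0. Qed.

Lemma dot_inj x y : (forall v, dot v x = dot v y) -> x = y.
Proof.
move=> H; apply/eqP; rewrite -subr_eq0 -dot_eq0.
by rewrite dotDr dotNr H subrr.
Qed.

Lemma dot_CS x y : dot x y ^+ 2 <= dot x x * dot y y.
Proof.
have [->|x0] := eqVneq x 0; first by rewrite !dot0l expr0n mul0r.
have := dot_ge0 (dot x x *: y - dot x y *: x).
rewrite !dotE (dotC y x) => H.
have : 0 <= dot x x * (dot x x * dot y y - dot x y ^+ 2) by move: H; lra.
by rewrite pmulr_rge0 ?dot_gt0// subr_ge0.
Qed.

Lemma enorm_ge0 x : 0 <= enorm x.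
Proof. exact: sqrtr_ge0. Qed.

Lemma sqr_enorm x : enorm x ^+ 2 = dot x x.
Proof. by rewrite sqr_sqrtr// dot_ge0. Qed.

Lemma dot_enorm x y : dot x y <= enorm x * enorm y.
Proof.
rewrite (le_trans (ler_norm _))// -(@ler_pXn2r _ 2) ?nnegrE ?mulr_ge0 ?enorm_ge0//.
by rewrite exprMn !sqr_enorm real_normK ?num_real// dot_CS.
Qed.

Lemma enorm_powR x (q : R) : enorm x `^ q = dot x x `^ (q / 2).
Proof. by rewrite /enorm -powR12_sqrt ?dot_ge0// -powRrM mulrC. Qed.

Lemma continuous_dot (T : topologicalType) (f g : T -> 'rV[R]_d) (z : T) :
  {for z, continuous f} -> {for z, continuous g} ->
  {for z, continuous (fun t => dot (f t) (g t))}.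
Proof.
move=> cf cg; rewrite /dot.
have co (h : T -> 'rV[R]_d) i :
    {for z, continuous h} -> h t 0 i @[t --> z] --> h z 0 i.
  move=> ch.
  exact: (cvg_comp h (fun M : 'rV[R]_d => M 0 i) ch (@coord_continuous _ _ _ 0 i _)).
apply: cvg_big => [|i _]; first exact: add_continuous.
by apply: cvgM; exact: co.
Qed.

Lemma continuous_enorm : continuous (@enorm R d).
Proof.
move=> x.
have c : {for x, continuous (fun y : 'rV[R]_d => dot y y)}.
  by apply: (@continuous_dot _ id id); exact: cvg_id.
exact: (cvg_comp _ _ c (@sqrt_continuous R _)).
Qed.

End Dot.

Section MaxTests.
Context {R : realType}.
Implicit Types (a k : R -> R).

Lemma is_derive_quot a (t l : R) : is_derive t 1 a l ->
  h^-1 * (a (h + t) - a t) @[h --> (0 : R)^'] --> l.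
Proof.
move=> [da <-]; rewrite -[X in X @ _ --> _]/(fun h : R => _).
have -> : (fun h : R => h^-1 * (a (h + t) - a t)) =
    (fun h : R => h^-1 *: ((a \o shift t) (h *: 1) - a t)).
  by apply/funext => h /=; rewrite [h *: 1]mulr1.
exact: da.
Qed.

(** Only the past of [t] is compared: a maximum over a time interval may sit at its right end, where
    just this sign survives. *)
Lemma left_max_derive_ge0 a (s t l : R) :
  is_derive t 1 a l -> s < t -> (forall r, s <= r <= t -> a r <= a t) -> 0 <= l.
Proof.
move=> /is_derive_quot/cvg_dnbhs_at_left cq st am.
rewrite -(cvg_lim _ cq)//; apply: limr_ge; first by apply/cvg_ex; exists l.
near=> h.
have h0 : h < 0 by near: h; exact: nbhs_left_lt.
have hs : s - t < h by near: h; apply: nbhs_left_gt; rewrite subr_lt0.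
by rewrite -mulrNN mulr_ge0 ?oppr_ge0 ?invr_le0 ?(ltW h0)// subr_le0 am//; lra.
Unshelve. all: by end_near. Qed.

Lemma first_order_max k (l : R) :
  is_derive (0 : R) 1 k l -> (forall s, k s <= k 0) -> l = 0.
Proof.
move=> dk km; apply/eqP; rewrite eq_le; apply/andP; split; last first.
  by apply: (@left_max_derive_ge0 k (-1) 0 l dk) => //; rewrite ltrN10.
rewrite -oppr_ge0; apply: (@left_max_derive_ge0 (k \o -%R) (-1) 0 (- l)).
- by rewrite -mulrN1; apply: is_derive1_comp; rewrite ?oppr0.
- by rewrite ltrN10.
- by move=> r _ /=; rewrite oppr0.
Qed.

(** If [l] were positive, [k1] would be positive just after 0 and [k] would exceed [k 0]. The
    derivative [k1] is asked for near 0 only, since the penalty is differentiated away from the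
    diagonal. *)
Lemma second_order_max k (k1 : R -> R) (l : R) :
  (\forall s \near (0 : R), is_derive (s : R) 1 k (k1 s)) ->
  is_derive (0 : R) 1 k1 l -> (forall s, k s <= k 0) -> k1 0 = 0 /\ l <= 0.
Proof.
move=> dk dk1 km.
have k10 : k1 0 = 0.
  by apply: first_order_max km; exact: nbhs_singleton dk.
split => //; rewrite leNgt; apply/negP => l0.
have /cvgr_gt/(_ _ l0) : h^-1 * k1 h @[h --> (0 : R)^'] --> l.
  have := is_derive_quot dk1; rewrite k10.
  by under eq_fun do rewrite addr0 subr0.
move=> /nbhs_ballP[e /= e0 He].
have /nbhs_ballP[e' /= e'0 He'] := dk.
pose r := Num.min e e' / 2.
have r0 : 0 < r by rewrite divr_gt0// lt_min e0.
have re : r < e /\ r < e'.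
  by apply/andP; rewrite -lt_min ltr_pdivrMr// ltr_pMr ?lt_min ?e0// ltr1n.
have [x||x] := @MVT R k k1 0 r r0.
- rewrite in_itv/= => /andP[x0 xr]; apply: He'.
  by rewrite /ball/= sub0r normrN gtr0_norm//; lra.
- apply/derivable_within_continuous => x; rewrite in_itv/= => /andP[x0 xr].
  have := He' x; rewrite /ball/= sub0r normrN ger0_norm// => H.
  by have [] : is_derive x 1 k (k1 x) by apply: H; lra.
- rewrite in_itv/= => /andP[x0 xr] E.
  have : 0 < x^-1 * k1 x.
    by apply: He; rewrite ?gt_eqF// /ball/= sub0r normrN gtr0_norm//; lra.
  rewrite pmulr_rgt0 ?invr_gt0// => k1x.
  have := km r; rewrite -subr_le0 E subr0 leNgt => /negP; apply.
  exact: mulr_gt0.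
Qed.

End MaxTests.

(** * Quadratic forms and the coupling bound *)

Section Frobenius.
Context {R : realType}.

(** The pairing tr(Q A^T); with a Hessian for [A] it is the second order part of [opA]. *)
Definition frob {n} (Q A : 'M[R]_n) : R := \sum_i \sum_j Q i j * A i j.

Lemma dotE_mx {n} (x y : 'rV[R]_n) : dot x y = (x *m y^T) 0 0.
Proof. by rewrite mxE; apply: eq_bigr => i _; rewrite mxE. Qed.

Lemma frobDl {n} (Q Q' A : 'M[R]_n) : frob (Q + Q') A = frob Q A + frob Q' A.
Proof.
rewrite -big_split; apply: eq_bigr => i _; rewrite -big_split.
by apply: eq_bigr => j _; rewrite mxE mulrDl.
Qed.

Lemma frobDr {n} (Q A A' : 'M[R]_n) : frob Q (A + A') = frob Q A + frob Q A'.
Proof.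
rewrite -big_split; apply: eq_bigr => i _; rewrite -big_split.
by apply: eq_bigr => j _; rewrite mxE mulrDr.
Qed.

Lemma frobZr {n} (a : R) (Q A : 'M[R]_n) : frob Q (a *: A) = a * frob Q A.
Proof.
rewrite mulr_sumr; apply: eq_bigr => i _; rewrite mulr_sumr.
by apply: eq_bigr => j _; rewrite mxE mulrCA.
Qed.

Lemma frob0l {n} (A : 'M[R]_n) : frob 0 A = 0.
Proof. by apply: big1 => i _; apply: big1 => j _; rewrite mxE mul0r. Qed.

Lemma frob_tr {n} (Q A : 'M[R]_n) : frob Q^T A^T = frob Q A.
Proof.
by rewrite /frob exchange_big; apply: eq_bigr => i _; apply: eq_bigr => j _; rewrite !mxE.
Qed.

Lemma frob_dyad {n} (v : 'rV[R]_n) (A : 'M[R]_n) :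
  frob (v^T *m v) A = dot (v *m A) v.
Proof.
rewrite /frob exchange_big; apply: eq_bigr => j _.
rewrite mxE mulr_suml; apply: eq_bigr => i _.
by rewrite mxE big_ord1 mxE mulrAC.
Qed.

(** Cholesky elimination of the first coordinate: one dyad reproduces the first row and column, and
    induction applies to the Schur complement [Q2]. It reduces traces against [Q] to values of
    quadratic forms. *)
Lemma posdef_dyads {n} (Q : 'M[R]_n) : Q^T = Q ->
  (forall v, v != 0 -> 0 < dot (v *m Q) v) ->
  exists s : seq 'rV[R]_n, Q = \sum_(v <- s) v^T *m v.
Proof.
elim: n Q => [|n IH] Q sQ pQ.
  by exists [::]; rewrite big_nil [Q]flatmx0.
move: Q sQ pQ; rewrite -add1n => Q sQ pQ.
pose a := Q 0 0; pose u : 'rV[R]_n := ursubmx Q; pose Q1 := drsubmx Q.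
have QE : Q = block_mx a%:M u u^T Q1.
  rewrite -[LHS]submxK /u; congr block_mx.
    by rewrite [LHS]mx11_scalar; congr (_%:M); rewrite !mxE lshift0.
  by rewrite trmx_ursub sQ.
have e0 : (row_mx 1 0 : 'rV[R]_(1 + n)) != 0.
  by apply: contra_neq (oner_neq0 R) => /rowP/(_ (lshift n 0)); rewrite row_mxEl !mxE eqxx.
have a0 : 0 < a.
  have := pQ _ e0; rewrite QE dotE_mx mul_row_block tr_row_mx mul_row_col.
  by rewrite !mul1mx !mul0mx trmx0 mulmx0 trmx1 mulmx1 !addr0 mxE eqxx.
have sQ1 : Q1^T = Q1 by rewrite /Q1 trmx_drsub sQ.
pose Q2 := Q1 - a^-1 *: (u^T *m u).
have [||s sE] := IH Q2.
- by rewrite /Q2 linearB linearZ/= trmx_mul trmxK sQ1.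
- move=> v v0.
  (* This [t] minimises the form of [Q] at (t, v) over the first coordinate; the minimum is the form
     of [Q2] at [v]. *)
  pose t : 'rV[R]_1 := - a^-1 *: (v *m u^T).
  have tv0 : row_mx t v != 0.
    by apply: contra_neq v0 => /eqP; rewrite row_mx_eq0 => /andP[_ /eqP].
  have := pQ _ tv0; congr (0 < _).
  have tT : t^T = - a^-1 *: (u *m v^T) by rewrite /t linearZ/= trmx_mul trmxK.
  rewrite QE !dotE_mx mul_row_block tr_row_mx mul_row_col; congr (fun_of_matrix _ 0 0).
  have -> : t *m a%:M + v *m u^T = 0.
    by rewrite mul_mx_scalar scalerA mulrN divff ?gt_eqF// scaleN1r addNr.
  rewrite mul0mx add0r; congr (_ *m _).
  by rewrite /Q2 mulmxBr -scalemxAr mulmxA /t scaleNr mulNmx -scalemxAl addrC.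
- pose sa := Num.sqrt a.
  have sa0 : sa != 0 by rewrite gt_eqF// sqrtr_gt0.
  have saa : sa * sa = a by rewrite -expr2 sqr_sqrtr// ltW.
  exists (row_mx sa%:M (sa^-1 *: u) :: map (fun v : 'rV[R]_n => row_mx 0 v) s).
  rewrite big_cons big_map QE.
  have -> : \sum_(v <- s) (row_mx (0 : 'M[R]_1) v)^T *m row_mx (0 : 'M[R]_1) v =
      block_mx 0 0 0 Q2.
    rewrite sE; elim: s {sE} => [|v s IHs]; first by rewrite !big_nil; rewrite block_mx0.
    rewrite !big_cons IHs tr_row_mx mul_col_row !trmx0 !mul0mx mulmx0.
    by rewrite add_block_mx !addr0.
  have uT : (sa^-1 *: u)^T = sa^-1 *: u^T by rewrite linearZ.
  rewrite tr_row_mx mul_col_row add_block_mx !addr0 tr_scalar_mx uT.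
  rewrite !mul_scalar_mx mul_mx_scalar -!scalemxAl -!scalemxAr !scalerA.
  rewrite scale_scalar_mx saa ?mulfV// ?mulVf// !scale1r -invfM saa.
  by rewrite /Q2 addrC subrK.
Qed.

Lemma frob_le0 {n} (Q A : 'M[R]_n) : Q^T = Q ->
  (forall v, v != 0 -> 0 < dot (v *m Q) v) ->
  (forall v, dot (v *m A) v <= 0) -> frob Q A <= 0.
Proof.
move=> sQ pQ nA; have [s ->] := posdef_dyads sQ pQ.
elim: s => [|v s IH]; first by rewrite big_nil frob0l.
by rewrite big_cons frobDl frob_dyad ler_wnDl.
Qed.

End Frobenius.

(* If [v M v + c |w - v|^2 >= w B w] for all v, w, then [hopf_lax s] is the quadratic
   form [w |-> inf_v v M v + (c / s) |w - v|^2]: it starts at M, dominates B at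
   time 1 and solves [X' = - X^2 / c]. *)
Section HopfLax.
Context {R : realType} {n : nat}.
Variables (M : 'M[R]_n) (c tau : R).
Hypotheses (sM : M^T = M) (c0 : 0 < c) (tau0 : 0 < tau).
Hypothesis M_lb : forall v, tau * dot v v <= dot (v *m M) v + c * dot v v.

Definition hopf_lax_den (s : R) : 'M[R]_n := 1%:M + (s / c) *: M.
Definition hopf_lax (s : R) : 'M[R]_n := M *m invmx (hopf_lax_den s).

(** Up to the factor [c], the form of the denominator is (1 - s) c |v|^2 plus [s] times the form
    bounded below in [M_lb], hence positive on nonzero vectors. *)
Lemma hopf_lax_den_unit (s : R) : 0 <= s <= 1 -> hopf_lax_den s \in unitmx.
Proof.
move=> /andP[s0 s1]; rewrite unitmxE unitfE; apply/negP => /det0P[v v0 E].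
have : dot (v *m hopf_lax_den s) v = 0 by rewrite E dot0l.
rewrite mulmxDr mulmx1 -scalemxAr dotDl dotZl => H.
have vv : 0 < dot v v by rewrite dot_gt0.
have : c * dot v v + s * dot (v *m M) v = 0.
  rewrite -[RHS](mulr0 c) -H mulrDr; congr (_ + _).
  by field; rewrite gt_eqF.
have := M_lb v => ? ?.
have : s * (tau * dot v v) <= s * (dot (v *m M) v + c * dot v v).
  by rewrite ler_wpM2l.
have : 0 <= s * (tau * dot v v) by rewrite !mulr_ge0 ?(ltW tau0) ?(ltW vv).
have tv : 0 < tau * dot v v by rewrite mulr_gt0.
have [s1E|s10] := eqVneq s 1; first by subst s; lra.
have : 0 < (1 - s) * (c * dot v v).
  by rewrite !mulr_gt0// subr_gt0 lt_neqAle s10.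
lra.
Qed.

Lemma hopf_lax_den_comm s : hopf_lax_den s *m M = M *m hopf_lax_den s.
Proof.
by rewrite /hopf_lax_den mulmxDl mulmxDr mul1mx mulmx1 -scalemxAl -scalemxAr.
Qed.

Lemma hopf_lax_comm (s : R) : 0 <= s <= 1 -> hopf_lax s = invmx (hopf_lax_den s) *m M.
Proof.
move=> /hopf_lax_den_unit u.
by rewrite /hopf_lax -[in LHS](mulKmx u M) hopf_lax_den_comm !mulmxA mulmxK// .
Qed.

Lemma hopf_lax_sym (s : R) : 0 <= s <= 1 -> (hopf_lax s)^T = hopf_lax s.
Proof.
move=> s01; rewrite {2}hopf_lax_comm// /hopf_lax trmx_mul trmx_inv sM.
by rewrite /hopf_lax_den linearD linearZ/= trmx1 sM.
Qed.

Lemma hopf_lax0 : hopf_lax 0 = M.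
Proof. by rewrite /hopf_lax /hopf_lax_den mul0r scale0r addr0 invmx1 mulmx1. Qed.

Lemma hopf_lax1_ge (B : 'M[R]_n) :
  (forall v w, dot (w *m B) w <= dot (v *m M) v + c * dot (w - v) (w - v)) ->
  forall w, dot (w *m B) w <= dot (w *m hopf_lax 1) w.
Proof.
move=> H w.
have u1 : hopf_lax_den 1 \in unitmx by apply: hopf_lax_den_unit; rewrite ler01 lexx.
(* The minimiser of v M v + c |w - v|^2, whose minimum is the form of [hopf_lax 1] at [w]. *)
pose v := w *m invmx (hopf_lax_den 1).
have wE : w = v + c^-1 *: (v *m M).
  rewrite -[LHS](mulmxKV u1) -/v {1}/hopf_lax_den mulmxDr mulmx1 div1r.
  by rewrite -scalemxAr.
apply: le_trans (H v w) _.
have -> : w *m hopf_lax 1 = v *m M.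
  by rewrite hopf_lax_comm ?ler01 ?lexx// mulmxA.
have -> : w - v = c^-1 *: (v *m M) by rewrite {1}wE addrC addKr.
rewrite [X in _ <= dot _ X]wE !dotE mulrA mulfV ?gt_eqF// mul1r.
by rewrite lexx.
Qed.

(** The resolvent identity; divided by r - s it becomes the Riccati equation in the limit. *)
Lemma hopf_lax_sub (s r : R) : 0 <= s <= 1 -> hopf_lax_den r \in unitmx ->
  hopf_lax r - hopf_lax s = - ((r - s) / c) *: (hopf_lax r *m hopf_lax s).
Proof.
move=> s01 ur; have us := hopf_lax_den_unit s01.
have E : hopf_lax_den s - hopf_lax_den r = - ((r - s) / c) *: M.
  by rewrite /hopf_lax_den opprD addrACA subrr add0r -scalerBl -mulrBl -mulNr opprB.
have F : invmx (hopf_lax_den r) - invmx (hopf_lax_den s) =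
    invmx (hopf_lax_den r) *m (hopf_lax_den s - hopf_lax_den r) *m invmx (hopf_lax_den s).
  by rewrite mulmxBr mulmxBl mulmxK// mulVmx// mul1mx.
by rewrite /hopf_lax -mulmxBr F E -scalemxAr -scalemxAl -scalemxAr !mulmxA.
Qed.

(** With polynomial entries the determinant and the adjugate are polynomials in the parameter, so
    the inverse inherits their continuity. *)
Lemma hopf_lax_den_horner : exists P : 'M[{poly R}]_n,
  forall r, hopf_lax_den r = map_mx (horner_eval r) P.
Proof.
exists (1%:M + \matrix_(i, j) ((c^-1 * M i j) *: 'X)) => r.
apply/matrixP => i j; rewrite !mxE /horner_eval hornerD hornerZ hornerX.
by rewrite hornerMn hornerC; ring.
Qed.

(** Invertibility extends slightly beyond [0, 1], so that the derivatives at 0 and 1 are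
    two-sided. *)
Lemma hopf_lax_near_unit (s : R) : 0 <= s <= 1 ->
  \forall r \near s, hopf_lax_den r \in unitmx.
Proof.
have [P PE] := hopf_lax_den_horner.
move=> /hopf_lax_den_unit; rewrite unitmxE unitfE PE det_map_mx /= /horner_eval => d0.
near=> r; rewrite unitmxE unitfE PE det_map_mx /= /horner_eval.
by near: r; apply: (@cvgr_neq0 _ R^o) d0; exact: continuous_horner.
Unshelve. all: by end_near. Qed.

Lemma hopf_lax_continuous (s : R) i j : 0 <= s <= 1 ->
  {for s, continuous (fun r => hopf_lax r i j)}.
Proof.
move=> s01; have [P PE] := hopf_lax_den_horner.
have := hopf_lax_den_unit s01; rewrite unitmxE unitfE PE det_map_mx /= /horner_eval => d0.
have E r : hopf_lax_den r \in unitmx ->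
    hopf_lax r i j = \sum_k M i k * ((\det P).[r]^-1 * (\adj P k j).[r]).
  move=> ur; rewrite /hopf_lax mxE; apply: eq_bigr => k _; congr (_ * _).
  by rewrite /invmx ur mxE PE det_map_mx -map_mx_adj !mxE.
rewrite /prop_for /continuous_at (E s) ?hopf_lax_den_unit//.
have H : \sum_k M i k * ((\det P).[r]^-1 * (\adj P k j).[r]) @[r --> s] -->
    \sum_k M i k * ((\det P).[s]^-1 * (\adj P k j).[s]).
  apply: cvg_big => [|k _]; first exact: add_continuous.
  apply: cvgMl_tmp; apply: cvgM; last exact: continuous_horner.
  by apply: cvgV => //; exact: continuous_horner.
apply: cvg_trans H.
apply: near_eq_cvg; near=> r.
by apply/esym/E; near: r; exact: hopf_lax_near_unit.
Unshelve. all: by end_near. Qed.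

Lemma hopf_lax_is_derive (s : R) i j : 0 <= s <= 1 ->
  is_derive s 1 (fun r => hopf_lax r i j) (- c^-1 * (hopf_lax s *m hopf_lax s) i j).
Proof.
move=> s01.
have chs : h + s @[h --> (0 : R)] --> s.
  by rewrite -[X in _ --> X]add0r; apply: cvgD; [exact: cvg_id|exact: cvg_cst].
have uh : \forall h \near (0 : R)^', hopf_lax_den (h + s) \in unitmx.
  have chs' : h + s @[h --> (0 : R)^'] --> s by exact: cvg_within_filter.
  exact: (chs' _ (hopf_lax_near_unit s01)).
have cq : - c^-1 * (hopf_lax (h + s) *m hopf_lax s) i j @[h --> (0 : R)^'] -->
    - c^-1 * (hopf_lax s *m hopf_lax s) i j.
  apply: cvgMl_tmp.
  rewrite mxE; under eq_fun do rewrite mxE.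
  apply: cvg_big => [|k _]; first exact: add_continuous.
  apply: cvgMr_tmp; apply: cvg_within_filter.
  exact: (cvg_comp _ _ chs (@hopf_lax_continuous s i k s01)).
suff cD : h^-1 *: (hopf_lax (h *: 1 + s) i j - hopf_lax s i j) @[h --> (0 : R)^'] -->
    - c^-1 * (hopf_lax s *m hopf_lax s) i j.
  apply: DeriveDef; last exact/cvg_lim.
  by apply/cvg_ex; exists (- c^-1 * (hopf_lax s *m hopf_lax s) i j).
apply: cvg_trans cq; apply: near_eq_cvg; near=> h.
have h0 : h != 0 by near: h; exact: nbhs_dnbhs_neq.
have u : hopf_lax_den (h + s) \in unitmx by near: h.
have := hopf_lax_sub s01 u; rewrite addrK => /matrixP/(_ i j) E.
rewrite [h *: 1]mulr1.
have -> (a b : R) : a *: (b : R^o) = a * b by [].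
have -> : hopf_lax (h + s) i j - hopf_lax s i j =
    (hopf_lax (h + s) - hopf_lax s) i j by rewrite !mxE.
have EZ a (X : 'M[R]_n) : (a *: X) i j = a * X i j by rewrite mxE.
by rewrite E EZ; field; rewrite gt_eqF.
Unshelve. all: by end_near. Qed.

End HopfLax.

Section Coupling.
Context {R : realType} {n : nat}.
Variables (Q dQ : R -> 'M[R]_n) (e bb db : R -> R) (A B : 'M[R]_n) (c K : R).
Hypotheses (c0 : 0 < c) (sQ : forall s, (Q s)^T = Q s).
Hypothesis Q_deriv : forall (s : R) i j, is_derive s 1 (fun r => Q r i j) (dQ s i j).
Hypothesis b_deriv : forall s : R, is_derive s 1 bb (db s).
Hypothesis e0 : forall s, 0 < e s.
Hypothesis Q_lb : forall s v, e s * dot v v <= dot (v *m Q s) v.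
Hypothesis AB : forall v w,
  dot (w *m B) w <= dot (v *m A) v + c * dot (w - v) (w - v).
Hypothesis slope : forall s, 0 <= s <= 1 ->
  c / (4 * e s) * (\sum_i \sum_j dQ s i j ^+ 2) + db s <= K.

(* The term [tau] makes [1 + s M / c] invertible up to [s = 1]; it is sent to 0. *)
Let Asym (tau : R) : 'M[R]_n := 2^-1 *: (A + A^T) + tau%:M.

Let Asym_tr tau : (Asym tau)^T = Asym tau.
Proof. by rewrite linearD linearZ/= linearD/= trmxK tr_scalar_mx (addrC A^T). Qed.

Let Asym_quad tau v : dot (v *m Asym tau) v = dot (v *m A) v + tau * dot v v.
Proof.
have AT : dot (v *m A^T) v = dot (v *m A) v.
  by rewrite -!frob_dyad -frob_tr trmx_mul !trmxK.
by rewrite mulmxDr mul_mx_scalar -scalemxAr mulmxDr !dotE AT; field.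
Qed.

Let Asym_lb tau v : tau * dot v v <= dot (v *m Asym tau) v + c * dot v v.
Proof.
have := AB v 0; rewrite mul0mx dot0l sub0r !dotE opprK Asym_quad; lra.
Qed.

(** For symmetric [H] the trace of Q H^2 is the sum of the forms of [Q] at the rows of [H], and
    ellipticity applies to each row. *)
Lemma frob_row_lb s (H : 'M[R]_n) : H^T = H ->
  e s * (\sum_i \sum_j H i j ^+ 2) <= frob (Q s) (H *m H).
Proof.
move=> sH.
have -> : frob (Q s) (H *m H) = \sum_k dot (row k H *m Q s) (row k H).
  transitivity (\sum_i \sum_j \sum_k H k i * Q s i j * H k j).
    apply: eq_bigr => i _; apply: eq_bigr => j _; rewrite mxE mulr_sumr.
    by apply: eq_bigr => k _; rewrite -{1}sH mxE mulrA (mulrC (Q s i j)).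
  rewrite exchange_big/= (eq_bigr _ (fun j _ => exchange_big _ _ _ _ _ _)) exchange_big/=.
  apply: eq_bigr => k _; apply: eq_bigr => j _; rewrite !mxE mulr_suml.
  by apply: eq_bigr => i _; rewrite mxE.
rewrite mulr_sumr ler_sum// => k _; apply: le_trans (Q_lb s (row k H)).
rewrite le_eqVlt; apply/orP; left; apply/eqP; congr (_ * _).
by apply: eq_bigr => j _; rewrite mxE expr2.
Qed.

(** The Riccati term is negative quadratic in [H] and absorbs the linear term: completing the square
    entry by entry, the supremum of dQ . H - (e / c) |H|^2 is c |dQ|^2 / (4 e). *)
Lemma slope_bound s (H : 'M[R]_n) : H^T = H -> 0 <= s <= 1 ->
  frob (dQ s) H - c^-1 * frob (Q s) (H *m H) + db s <= K.
Proof.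
move=> sH s01; apply: le_trans (slope s01); rewrite lerD2r lerBlDr.
have es := e0 s.
have : c^-1 * (e s * (\sum_i \sum_j H i j ^+ 2)) <= c^-1 * frob (Q s) (H *m H).
  by rewrite ler_pM2l ?invr_gt0// frob_row_lb.
rewrite -(lerD2l (c / (4 * e s) * (\sum_i \sum_j dQ s i j ^+ 2))).
apply: le_trans.
rewrite mulrA !mulr_sumr -big_split ler_sum// => i _.
rewrite !mulr_sumr -big_split ler_sum// => j _ /=.
rewrite -subr_ge0.
have -> : c / (4 * e s) * dQ s i j ^+ 2 + c^-1 * e s * H i j ^+ 2 - dQ s i j * H i j
   = (e s / c) * (H i j - c / (2 * e s) * dQ s i j) ^+ 2.
  by field; rewrite !gt_eqF.
by rewrite mulr_ge0 ?sqr_ge0// divr_ge0// ltW.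
Qed.

(** The Hopf-Lax path [H] leads from the symmetrised [A], shifted by [tau], to a matrix dominating
    [B]. Hence the left side is at most the increment of frob (Q s) (H s) + bb s over [0, 1], up to
    the trace of the shift, and the mean value theorem reduces it to [slope_bound]. [A] need not be
    symmetric: its symmetric part has the same form and the same trace against the symmetric
    [Q 0]. *)
Lemma coupling_bound :
  frob (Q 1) B - frob (Q 0) A + (bb 1 - bb 0) <= K.
Proof.
have Qpos s v : v != 0 -> 0 < dot (v *m Q s) v.
  move=> v0; apply: lt_le_trans (Q_lb s v).
  by rewrite mulr_gt0 ?dot_gt0.
suff main (tau : R) : 0 < tau -> frob (Q 1) B - frob (Q 0) A + (bb 1 - bb 0) <=
    K + tau * frob (Q 0) 1%:M.
  have tr0 : 0 <= frob (Q 0) 1%:M.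
    rewrite -oppr_le0 -mulN1r -frobZr; apply: (frob_le0 (sQ 0) (Qpos 0)) => v.
    by rewrite scaleN1r mulmxN mulmx1 dotNl oppr_le0 dot_ge0.
  apply/ler_addgt0Pr => eps eps0.
  have t1 : 0 < 1 + frob (Q 0) 1%:M by rewrite ltr_wpDr.
  apply: le_trans (main (eps / (1 + frob (Q 0) 1%:M)) _) _; first by rewrite divr_gt0.
  by rewrite lerD2l mulrAC ler_pdivrMr// ler_pM2l// lerDr.
move=> tau0.
pose H := hopf_lax (Asym tau) c.
have sA := Asym_tr tau.
have lb := Asym_lb tau.
pose Th (s : R) := frob (Q s) (H s) + bb s.
pose dTh (s : R) := frob (dQ s) (H s) - c^-1 * frob (Q s) (H s *m H s) + db s.
have Thd (s : R) : 0 <= s <= 1 -> is_derive s 1 Th (dTh s).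
  move=> s01.
  have -> : Th = \sum_(i < n) \sum_(j < n) (fun r : R => Q r i j * H r i j) + bb.
    apply/funext => r; rewrite /Th /frob [RHS]/(_ + _) fct_sumE; congr (_ + _).
    by apply: eq_bigr => i _; rewrite fct_sumE.
  apply: is_deriveD.
  rewrite /frob mulr_sumr -sumrN -big_split/=.
  apply: is_derive_sum => i; rewrite mulr_sumr -sumrN -big_split/=.
  apply: is_derive_sum => j.
  have := hopf_lax_is_derive c0 tau0 lb i j s01 => dH.
  apply: (is_derive_eq (is_deriveM (Q_deriv s i j) dH)).
  by rewrite /GRing.scale/= /H; ring.
have [||s s01 E] := @MVT_segment R Th dTh 0 1 ler01.
- move=> s; rewrite in_itv/= => /andP[? ?].
  by refine (Thd s _); apply/andP; split; exact: ltW.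
- apply: derivable_within_continuous => r; rewrite in_itv/= => r01.
  by case: (Thd _ r01).
rewrite in_itv/= in s01.
have : dTh s <= K by exact: (slope_bound (hopf_lax_sym sA c0 tau0 lb s01) s01).
move: E; rewrite subr0 mulr1 => <-.
have -> : Th 0 = frob (Q 0) A + tau * frob (Q 0) 1%:M + bb 0.
  rewrite /Th /H hopf_lax0; congr (_ + _).
  rewrite frobDr frobZr frobDr -[X in frob X A^T]sQ frob_tr.
  have -> : (tau%:M : 'M[R]_n) = tau *: 1%:M by rewrite scalemx1.
  by rewrite frobZr; field.
have : frob (Q 1) B <= frob (Q 1) (H 1).
  rewrite -subr_le0 -mulN1r -frobZr -frobDr; apply: (frob_le0 (sQ 1) (Qpos 1)) => v.
  rewrite mulmxDr scaleN1r mulmxN dotDl dotNl subr_le0.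
  apply: (hopf_lax1_ge c0 tau0 lb) => v' w; apply: le_trans (AB v' w) _.
  by rewrite lerD2r Asym_quad lerDl mulr_ge0 ?dot_ge0// ltW.
rewrite /Th; lra.
Qed.

End Coupling.

(** * Parabolic maximum principles *)

Section Penalty.
Context {R : realType} {d : nat}.
Implicit Types (h v : 'rV[R]_d) (a r : R).

Lemma sqnorm_line_is_derive h v r :
  is_derive r 1 (fun t : R => dot (h + t *: v) (h + t *: v))
    (2 * dot (h + r *: v) v).
Proof.
have -> : (fun t : R => dot (h + t *: v) (h + t *: v)) =
   (fun t => (dot v v *: 'X^2 + (2 * dot h v) *: 'X + (dot h h)%:P).[t]).
  apply/funext => t; rewrite !(hornerD, hornerZ, hornerXn, hornerX, hornerC).
  by rewrite !dotE (dotC v h); ring.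
apply: is_derive_eq.
rewrite !(derivD, derivZ, derivXn, derivX, derivC).
rewrite !(hornerD, hornerZ, hornerMn, hornerXn, hornerX, hornerC) !dotE.
by rewrite /= expr1; ring.
Qed.

Lemma penalty_is_derive h v a r : h + r *: v != 0 ->
  is_derive r 1 (fun t : R => dot (h + t *: v) (h + t *: v) `^ a)
    (2 * a * dot (h + r *: v) (h + r *: v) `^ (a - 1) * dot (h + r *: v) v).
Proof.
rewrite -dot_gt0 => n0.
have H := is_derive1_comp (is_derive1_powR a n0) (sqnorm_line_is_derive h v r).
by apply: (is_derive_eq H); ring.
Qed.

Lemma penalty_is_derive_near h v a : h != 0 -> \forall r \near (0 : R),
  is_derive (r : R) 1 (fun t : R => dot (h + t *: v) (h + t *: v) `^ a)
    (2 * a * dot (h + r *: v) (h + r *: v) `^ (a - 1) * dot (h + r *: v) v).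
Proof.
move=> h0; near=> r; apply: penalty_is_derive; rewrite -dot_eq0.
near: r; apply: (@cvgr_neq0 _ R^o).
  exact: is_derive_continuous (sqnorm_line_is_derive h v 0).
by rewrite scale0r addr0 dot_eq0.
Unshelve. all: by end_near. Qed.

(** The exact value is 2 a N^(a-1) |v|^2 + 4 a (a-1) N^(a-2) (h . v)^2 with N = |h|^2. As a >= 1,
    Cauchy-Schwarz bounds it by its value for [v] parallel to [h], which produces the factor 2 a -
    1. *)
Lemma penalty_second_derive h v a : h != 0 -> 1 <= a ->
  exists2 l, is_derive (0 : R) 1 (fun r : R => 2 * a *
      dot (h + r *: v) (h + r *: v) `^ (a - 1) * dot (h + r *: v) v) l &
    l <= 2 * a * (2 * a - 1) * dot h h `^ (a - 1) * dot v v.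
Proof.
move=> h0 a1; have n0 : 0 < dot h h by rewrite dot_gt0.
have hE : h + 0 *: v = h by rewrite scale0r addr0.
have d1 : is_derive (0 : R) 1 (fun r : R => dot (h + r *: v) (h + r *: v) `^ (a - 1))
    (2 * (a - 1) * dot h h `^ (a - 1 - 1) * dot h v).
  by have := @penalty_is_derive h v (a - 1) 0; rewrite hE; apply.
have d2 : is_derive (0 : R) 1 (fun r : R => dot (h + r *: v) v) (dot v v).
  have -> : (fun r : R => dot (h + r *: v) v) = (fun r => (dot v v *: 'X + (dot h v)%:P).[r]).
    by apply/funext => t; rewrite !(hornerD, hornerZ, hornerX, hornerC) !dotE; ring.
  apply: is_derive_eq; rewrite !(derivD, derivZ, derivX, derivC).
  by rewrite !hornerE.
have d3 := is_deriveZ (2 * a) (is_deriveM d1 d2).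
eexists.
  have -> : (fun r : R => 2 * a * dot (h + r *: v) (h + r *: v) `^ (a - 1) *
       dot (h + r *: v) v) =
      (2 * a) \*: ((fun r : R => dot (h + r *: v) (h + r *: v) `^ (a - 1)) *
                   (fun r : R => dot (h + r *: v) v)).
    by apply/funext => r; rewrite -mulrA.
  exact: d3.
rewrite /= hE /GRing.scale/=.
have -> : 2 * a * (2 * a - 1) * dot h h `^ (a - 1) * dot v v =
   2 * a * (dot h h `^ (a - 1) * dot v v + 2 * (a - 1) * dot h h `^ (a - 1) * dot v v) by ring.
rewrite ler_wpM2l ?mulr_ge0//; first by lra.
rewrite lerD2l.
have -> : dot h h `^ (a - 1) = dot h h `^ (a - 1 - 1) * dot h h.
  rewrite -[X in _ * X]powRr1 ?ltW// -powRD; first by congr (_ `^ _); ring.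
  by rewrite (gt_eqF n0) implybT.
rewrite mulrC -!mulrA ler_pM2l// ler_wpM2l ?subr_ge0// ler_wpM2l ?powR_ge0//.
by rewrite -expr2 dot_CS.
Qed.

End Penalty.

Section Topology.
Context {R : realType}.

(** The case l = 0 is the one of interest: the penalty vanishes on the diagonal and must be
    continuous there. *)
Lemma cvg_powR_ge0 {T : Type} (F : set_system T) {FF : Filter F} (f : T -> R)
    (l a : R) : (forall t, 0 <= f t) -> 0 <= l -> 0 < a ->
  f @ F --> l -> f t `^ a @[t --> F] --> l `^ a.
Proof.
move=> f0; rewrite le_eqVlt => /predU1P[<- a0 fl|l0 a0 fl]; last first.
  apply: (cvg_comp f (fun r : R => r `^ a) fl).
  exact: is_derive_continuous (is_derive1_powR a l0).
rewrite powR0 ?gt_eqF//; apply/(@cvgrPdist_lt _ R^o) => e e0.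
near=> t; rewrite sub0r normrN ger0_norm ?powR_ge0//.
have -> : e = (e `^ a^-1) `^ a by rewrite -powRrM mulVf ?gt_eqF// powRr1// ltW.
rewrite gt0_ltr_powR ?nnegrE ?powR_ge0//.
by near: t; apply: cvgr_lt fl _ _; rewrite powR_gt0.
Unshelve. all: by end_near. Qed.

Lemma within_continuous_precomp {X Y Z : topologicalType} (S : set X) (D : set Y)
    (g : X -> Y) (f : Y -> Z) : continuous g -> (forall x, S x -> D (g x)) ->
  {within D, continuous f} -> {within S, continuous (f \o g)}.
Proof.
move=> cg SD /subspace_continuousP cf; apply/subspace_continuousP => x Sx.
apply: cvg_comp (cf _ (SD _ Sx)) => U /cg; rewrite /nbhs/= => nU.
apply: filterS nU => y + Sy; apply; exact: SD.
Qed.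

Lemma continuous_for_fst {X Y Z : topologicalType} (f : X -> Y * Z) z :
  {for z, continuous f} -> {for z, continuous (fst \o f)}.
Proof. by move=> cf; apply: (cvg_comp _ _ cf); exact: cvg_fst. Qed.

Lemma continuous_for_snd {X Y Z : topologicalType} (f : X -> Y * Z) z :
  {for z, continuous f} -> {for z, continuous (snd \o f)}.
Proof. by move=> cf; apply: (cvg_comp _ _ cf); exact: cvg_snd. Qed.

Lemma continuous_for_pair {X Y Z : topologicalType} (f : X -> Y) (g : X -> Z) z :
  {for z, continuous f} -> {for z, continuous g} ->
  {for z, continuous (fun t => (f t, g t))}.
Proof. by move=> cf cg; exact: (cvg_pair cf cg). Qed.

Lemma enorm_coord {d} (x : 'rV[R]_d) i : `|x 0 i| <= enorm x.
Proof.
rewrite -sqrtr_sqr ler_wsqrtr// /dot (bigD1 i)//= expr2 lerDl sumr_ge0// => j _.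
by rewrite -expr2 sqr_ge0.
Qed.

Lemma compact_eball {d} (r : R) : compact [set x : 'rV[R]_d | enorm x <= r].
Proof.
apply: bounded_closed_compact.
  exists r; split; first exact: num_real.
  move=> M rM x /= xr; rewrite [`|x|]mx_normrE; apply: bigmax_le => [|[k i] _ /=].
    by rewrite (le_trans (enorm_ge0 x))// (le_trans xr)// ltW.
  by rewrite ord1 (le_trans (enorm_coord x i))// (le_trans xr)// ltW.
rewrite -[X in closed X]/(@enorm R d @^-1` [set y | y <= r]).
by apply: preimage_closed; [move=> x _; exact: continuous_enorm | exact: closed_le].
Qed.

End Topology.

Section OnePoint.
Context {R : realType} {d : nat}.
Variables (q : R -> 'rV[R]_d -> 'M[R]_d) (b : R -> 'rV[R]_d -> 'rV[R]_d).

Lemma opA_frob t (phi : 'rV[R]_d -> R) x :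
  opA q b t phi x = frob (q t x) (hess phi x) + dot (b t x) (grad phi x).
Proof.
congr (_ + _); last by apply: eq_bigr => i _; rewrite mxE.
by apply: eq_bigr => i _; apply: eq_bigr => j _; rewrite mxE.
Qed.

Variables (s T : R).
Hypothesis q_sym : forall t x, s < t <= T -> (q t x)^T = q t x.
Hypothesis q_pos : forall t x v, s < t <= T -> v != 0 ->
  0 < dot (v *m q t x) v.

(** A positive maximum could lie neither far out nor at time [s]; at an interior one the gradient
    vanishes, the Hessian is nonpositive and the time derivative is nonnegative, against the strict
    inequality. Strictness is later supplied by a Lyapunov term. *)
Lemma one_point_max (v : R -> 'rV[R]_d -> R) (rad : R) :
  {within `[s, T]%classic `*` [set: 'rV[R]_d],
    continuous (fun z : R * 'rV[R]_d => v z.1 z.2)} ->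
  (forall t, s < t <= T -> C2 (v t)) ->
  (forall t x, s < t <= T -> derivable (v^~ x) t 1) ->
  (forall t x, s < t <= T -> derive1 (v^~ x) t < opA q b t (v t) x) ->
  (forall t x, s <= t <= T -> rad < enorm x -> v t x <= 0) ->
  (forall x, v s x <= 0) ->
  forall t x, s <= t <= T -> v t x <= 0.
Proof.
move=> cv v2 vt vA vrad vs t1 x1 /andP[st1 t1T]; rewrite leNgt; apply/negP => v1.
have sT : s <= T by exact: le_trans t1T.
(* The ball also contains [x1], so the maximum over it is positive and therefore global in space. *)
pose K := [set x : 'rV[R]_d | enorm x <= Num.max rad (enorm x1)].
have Kx1 : K x1 by rewrite /K/= le_max lexx orbT.
have [|||[t0 x0]] := @compact_EVT_max _ R
  (fun z : R * 'rV[R]_d => v z.1 z.2) (`[s, T]%classic `*` K).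
- by exists (t1, x1); split => //=; rewrite in_itv/= st1.
- by apply: compact_setX; [exact: segment_compact | exact: compact_eball].
- by apply: continuous_subspaceW cv => -[? ?] [].
rewrite inE => -[]/=; rewrite in_itv/= => /andP[st0 t0T] K0 mx.
have {}mx t x : s <= t <= T -> K x -> v t x <= v t0 x0.
  by move=> t01 Kx; apply: (mx (t, x)); rewrite inE; split.
have v0 : 0 < v t0 x0 by apply: lt_le_trans v1 (mx _ _ _ Kx1); rewrite st1.
have st0' : s < t0 <= T.
  rewrite t0T andbT lt_neqAle st0 andbT; apply/eqP => E.
  by move: v0; rewrite -E ltNge vs.
have mxx x : v t0 x <= v t0 x0.
  have [Kx|] := boolP (enorm x <= Num.max rad (enorm x1)); first by rewrite mx// st0.
  rewrite -ltNge gt_max => /andP[rx _].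
  by rewrite (le_trans _ (ltW v0))// vrad// st0.
have key w : dot w (grad (v t0) x0) = 0 /\ dot (w *m hess (v t0) x0) w <= 0.
  have E : x0 + 0 *: w = x0 by rewrite scale0r addr0.
  have := @second_order_max R (fun r => v t0 (x0 + r *: w))
    (fun r => dot w (grad (v t0) (x0 + r *: w))) (dot (w *m hess (v t0) x0) w).
  rewrite E; apply; last by move=> r; exact: mxx.
  - by near=> r; apply: C1_line; exact: (v2 _ st0').1.
  - by have := C2_line x0 w 0 (v2 _ st0'); rewrite E.
have g0 : grad (v t0) x0 = 0.
  by apply: dot_inj => w; rewrite dot0r (key w).1.
have := vA t0 x0 st0'; apply/negP; rewrite -leNgt opA_frob g0 dot0r addr0.
have dv := derivableP (vt t0 x0 st0').
apply: (@le_trans _ _ 0).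
  apply: frob_le0; first exact: q_sym.
    by move=> w w0; exact: q_pos.
  by move=> w; exact: (key w).2.
rewrite derive1E; apply: left_max_derive_ge0 dv (proj1 (andP st0')) _ => r /andP[sr rt].
by apply: mx => //; rewrite sr (le_trans rt).
Unshelve. all: by end_near. Qed.

End OnePoint.

Section TwoPoint.
Context {R : realType} {d : nat}.
Variables (q : R -> 'rV[R]_d -> 'M[R]_d) (b : R -> 'rV[R]_d -> 'rV[R]_d).
Variables (eta m r : R -> 'rV[R]_d -> R) (s T a kappa : R).
Hypothesis q_sym : forall t x, s < t <= T -> (q t x)^T = q t x.
Hypothesis q_C1 : forall t i j, s < t <= T -> C1 (fun x => q t x i j).
Hypothesis b_C1 : forall t i, s < t <= T -> C1 (fun x => b t x 0 i).
Hypothesis eta_gt0 : forall t x, s < t <= T -> 0 < eta t x.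
Hypothesis q_lb : forall t x v, s < t <= T ->
  eta t x * dot v v <= dot (v *m q t x) v.
Hypothesis dq_bound : forall t x i j k, s < t <= T ->
  pder k (fun y => q t y i j) x ^+ 2 <= m t x * eta t x.
Hypothesis jac_bound : forall t x v, s < t <= T ->
  qform (jac (b t) x) v <= r t x * dot v v.
Hypothesis a_ge1 : 1 <= a.
Hypothesis kappa_bound : forall t x, s < t <= T ->
  r t x + (2 * a - 1) * (d%:R ^+ 3 * m t x / 4) <= kappa.

(* The exponent of the penalty is q = 2 a. The second order conditions are tested
   in the directions (xi, ze) of the doubled variable (x, y); no coupling of the
   two diffusions has to be constructed, as coupling_bound works on the dual side. *)
Lemma generator_two_point_bound (al B : 'rV[R]_d -> R) (t P : R) (x y : 'rV[R]_d) :
  s < t <= T -> C2 al -> C2 B -> 0 < P -> y != x ->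
  (forall x' y', al y' - B x' - P * dot (y' - x') (y' - x') `^ a <=
    al y - B x - P * dot (y - x) (y - x) `^ a) ->
  opA q b t al y - opA q b t B x <=
    2 * a * kappa * (P * dot (y - x) (y - x) `^ a).
Proof.
move=> st al2 B2 P0 yx mx.
pose h := y - x; pose N := dot h h.
have h0 : h != 0 by rewrite subr_eq0.
have N0 : 0 < N by rewrite dot_gt0.
(* [w] is the gradient of the penalty in [y], and [c] the bound of its second derivative from
   [penalty_second_derive]. *)
pose w : 'rV[R]_d := (P * (2 * a) * N `^ (a - 1)) *: h.
pose c := P * (2 * a * (2 * a - 1) * N `^ (a - 1)).
have c0 : 0 < c by rewrite !mulr_gt0 ?powR_gt0//; move: a_ge1; lra.
have NaE : N `^ a = N `^ (a - 1) * N by rewrite mulrC mulr_powRB1 ?ltW// (lt_le_trans ltr01).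
have key xi ze : dot ze (grad al y) - dot xi (grad B x) - dot (ze - xi) w = 0 /\
  dot (ze *m hess al y) ze <= dot (xi *m hess B x) xi + c * dot (ze - xi) (ze - xi).
  have [l dl lle] := penalty_second_derive (ze - xi) h0 a_ge1.
  have hE : h + 0 *: (ze - xi) = h by rewrite scale0r addr0.
  have xE : x + 0 *: xi = x by rewrite scale0r addr0.
  have yE : y + 0 *: ze = y by rewrite scale0r addr0.
  pose g z := dot (h + z *: (ze - xi)) (h + z *: (ze - xi)).
  pose dg z := 2 * a * g z `^ (a - 1) * dot (h + z *: (ze - xi)) (ze - xi).
  have := @second_order_max R
    (fun z => al (y + z *: ze) - B (x + z *: xi) - P * g z `^ a)
    (fun z => dot ze (grad al (y + z *: ze)) - dot xi (grad B (x + z *: xi)) - P * dg z)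
    (dot (ze *m hess al y) ze - dot (xi *m hess B x) xi - P * l).
  case.
  - near=> z.
    have D1 := C1_line y ze z al2.1.
    have D2 := C1_line x xi z B2.1.
    have D3 : is_derive (z : R) 1 (fun z => g z `^ a) (dg z).
      by near: z; exact: penalty_is_derive_near.
    exact: (is_deriveB (is_deriveB D1 D2) (is_deriveZ P D3)).
  - have D1 := C2_line y ze 0 al2; rewrite yE in D1.
    have D2 := C2_line x xi 0 B2; rewrite xE in D2.
    exact: (is_deriveB (is_deriveB D1 D2) (is_deriveZ P dl)).
  - move=> z; rewrite /g hE xE yE.
    have -> : h + z *: (ze - xi) = (y + z *: ze) - (x + z *: xi).
      by rewrite /h scalerBr opprD addrACA.
    exact: mx.
  rewrite /dg /g hE xE yE => E1 E2; split.
  - by rewrite -[RHS]E1 /w dotZr (dotC _ h); congr (_ - _); rewrite /N; ring.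
  - have : P * l <= c * dot (ze - xi) (ze - xi).
      by rewrite /c -mulrA ler_pM2l.
    by move: E2; lra.
(* The directions (0, v) and (v, 0) show that both gradients equal [w], so the drift terms differ
   only through [b]. *)
have gal : grad al y = w.
  apply: dot_inj => v; have := (key 0 v).1.
  by rewrite dot0l !subr0 => /eqP; rewrite subr_eq0 => /eqP.
have gB : grad B x = w.
  apply: dot_inj => v; have := (key v 0).1.
  by rewrite dot0l !sub0r dotNl opprK => /eqP; rewrite addrC subr_eq0 => /eqP.
have zC (f : 'rV[R]_d -> R) (z : R) : C1 f ->
    is_derive z 1 (fun u => f (x + u *: h)) (dot h (grad f (x + z *: h))).
  by move=> f1; exact: C1_line.
pose Q z := q t (x + z *: h).
pose dQ z : 'M[R]_d := \matrix_(i, j) dot h (grad (fun x => q t x i j) (x + z *: h)).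
pose bb z := dot (b t (x + z *: h)) w.
pose db z := P * (2 * a) * N `^ (a - 1) * qform (jac (b t) (x + z *: h)) h.
have db_deriv (z : R) : is_derive z 1 bb (db z).
  have -> : bb = \sum_(i < d) w 0 i \*: (fun u => b t (x + u *: h) 0 i).
    apply/funext => u; rewrite fct_sumE /bb /dot; apply: eq_bigr => i _.
    by rewrite mulrC.
  have D i := is_deriveZ (w 0 i) (zC _ z (b_C1 i st)).
  apply: (is_derive_eq (is_derive_sum D)).
  rewrite /db /qform {2}/dot mulr_sumr; apply: eq_bigr => i _.
  have J : (h *m (jac (b t) (x + z *: h))^T) 0 i =
      dot h (grad (fun x => b t x 0 i) (x + z *: h)).
    by rewrite mxE; apply: eq_bigr => k _; rewrite !mxE.
  by rewrite J [w 0 i]mxE /GRing.scale/=; ring.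
have e0 z : 0 < eta t (x + z *: h) by exact: eta_gt0.
have := @coupling_bound R d Q dQ (fun z => eta t (x + z *: h)) bb db
  (hess B x) (hess al y) c (2 * a * kappa * (P * N `^ a)).
have xh : x + h = y by rewrite /h addrC subrK.
rewrite /Q /bb scale0r addr0 scale1r xh => H.
rewrite !opA_frob gal gB.
rewrite opprD addrACA; apply: H => //.
- by move=> z; exact: q_sym.
- by move=> z i j; apply: (is_derive_eq (zC _ z (q_C1 i j st))); rewrite mxE.
- by move=> z v; exact: q_lb.
- by move=> v v'; exact: (key v v').2.
move=> z z01; set X := x + z *: h.
(* One factor d comes from the d partial derivatives in Cauchy-Schwarz, two more in [dQs] from the
   d^2 entries. *)
have dQ2 i j : dQ z i j ^+ 2 <= N * (d%:R * (m t X * eta t X)).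
  rewrite mxE; apply: le_trans (dot_CS _ _) _; rewrite ler_wpM2l ?dot_ge0//.
  rewrite mulr_natl -[X in _ *+ X]card_ord -sumr_const ler_sum// => k _.
  by rewrite mxE -expr2 dq_bound.
have dQs : \sum_i \sum_j dQ z i j ^+ 2 <= d%:R ^+ 3 * N * (m t X * eta t X).
  apply: le_trans (_ : \sum_(i < d) \sum_(j < d) N * (d%:R * (m t X * eta t X)) <= _).
    by apply: ler_sum => i _; apply: ler_sum.
  rewrite !sumr_const card_ord -(mulr_natl (N * _)) -[leLHS]mulr_natl.
  by rewrite le_eqVlt; apply/orP; left; apply/eqP; ring.
have jb := jac_bound X h st.
have kb := kappa_bound X st.
rewrite /db NaE.
have Pn : 0 <= P * (2 * a) * N `^ (a - 1).
  by rewrite !mulr_ge0 ?powR_ge0 ?(ltW P0)//; move: a_ge1; lra.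
have -> : 2 * a * kappa * (P * (N `^ (a - 1) * N)) =
   P * (2 * a) * N `^ (a - 1) * (kappa * N) by ring.
apply: le_trans (_ : P * (2 * a) * N `^ (a - 1) *
  ((r t X + (2 * a - 1) * (d%:R ^+ 3 * m t X / 4)) * N) <= _); last first.
  by rewrite ler_wpM2l// ler_wpM2r// ltW.
have c4 : 0 <= c / (4 * eta t X).
  apply: divr_ge0; first exact: ltW.
  by apply: mulr_ge0 => //; exact: ltW (eta_gt0 X st).
apply: le_trans (lerD (ler_wpM2l c4 dQs) (ler_wpM2l Pn jb)) _.
rewrite le_eqVlt; apply/orP; left; apply/eqP; rewrite /c -/N.
by field; rewrite gt_eqF ?(eta_gt0 X st).
Unshelve. all: by end_near. Qed.

(** The weight of the penalty grows at the rate 2 a kappa of [generator_two_point_bound], so at a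
    positive maximum the strict inequality for [B] contradicts the sign of the time derivative. The
    last three hypotheses keep this maximum off the diagonal, in a compact set, and away from time
    [s]. *)
Lemma two_point_max (al B : R -> 'rV[R]_d -> R) (beta rad : R) :
  0 < beta ->
  {within `[s, T]%classic `*` [set: 'rV[R]_d],
    continuous (fun z : R * 'rV[R]_d => al z.1 z.2)} ->
  {within `[s, T]%classic `*` [set: 'rV[R]_d],
    continuous (fun z : R * 'rV[R]_d => B z.1 z.2)} ->
  (forall t, s < t <= T -> C2 (al t) /\ C2 (B t)) ->
  (forall t x, s < t <= T ->
    derivable (al^~ x) t 1 /\ derivable (B^~ x) t 1) ->
  (forall t x, s < t <= T -> derive1 (al^~ x) t <= opA q b t (al t) x) ->
  (forall t x, s < t <= T -> opA q b t (B t) x < derive1 (B^~ x) t) ->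
  (forall t x, s <= t <= T -> al t x <= B t x) ->
  (forall t x y, s <= t <= T -> rad < enorm x \/ rad < enorm y ->
     al t y - B t x <=
       beta * expR (2 * a * kappa * (t - s)) * dot (y - x) (y - x) `^ a) ->
  (forall x y, al s y - B s x <= beta * dot (y - x) (y - x) `^ a) ->
  forall t x y, s <= t <= T -> al t y - B t x <=
    beta * expR (2 * a * kappa * (t - s)) * dot (y - x) (y - x) `^ a.
Proof.
move=> beta0 cal cB alB2 dalB alA BA diag coer init t1 x1 y1 /andP[st1 t1T].
pose P (t : R) := beta * expR (2 * a * kappa * (t - s)).
have P0 t : 0 < P t by rewrite mulr_gt0// expR_gt0.
rewrite -/(P t1) -subr_le0 leNgt; apply/negP => v1.
have sT : s <= T by exact: le_trans t1T.
pose Psi (z : R * ('rV[R]_d * 'rV[R]_d)) := al z.1 z.2.2 - B z.1 z.2.1 -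
  P z.1 * dot (z.2.2 - z.2.1) (z.2.2 - z.2.1) `^ a.
pose rad' := Num.max rad (Num.max (enorm x1) (enorm y1)).
pose K := [set x : 'rV[R]_d | enorm x <= rad'].
have Kx1 : K x1 by rewrite /K/= !le_max lexx !orbT.
have Ky1 : K y1 by rewrite /K/= !le_max lexx !orbT.
have cPsi : {within `[s, T]%classic `*` (K `*` K), continuous Psi}.
  pose Z := (R * ('rV[R]_d * 'rV[R]_d))%type.
  have cid (z : Z) : {for z, continuous (fun z' : Z => z')} by exact: cvg_id.
  have c1 (z : Z) := continuous_for_fst (cid z).
  have cx (z : Z) := continuous_for_fst (continuous_for_snd (cid z)).
  have cy (z : Z) := continuous_for_snd (continuous_for_snd (cid z)).
  have C1' : {within `[s, T]%classic `*` (K `*` K), continuous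
     (fun z : Z => al z.1 z.2.2)}.
    apply: (within_continuous_precomp (g := fun z : Z => (z.1, z.2.2))) cal.
      by move=> z; exact: continuous_for_pair (c1 z) (cy z).
    by move=> z [].
  have C2' : {within `[s, T]%classic `*` (K `*` K), continuous
     (fun z : Z => B z.1 z.2.1)}.
    apply: (within_continuous_precomp (g := fun z : Z => (z.1, z.2.1))) cB.
      by move=> z; exact: continuous_for_pair (c1 z) (cx z).
    by move=> z [].
  have C3' : continuous (fun z : Z =>
     P z.1 * dot (z.2.2 - z.2.1) (z.2.2 - z.2.1) `^ a).
    move=> z; apply: cvgM.
      have cP : continuous P.
        move=> t; apply: cvgMl_tmp.
        apply: (cvg_comp (fun t : R => 2 * a * kappa * (t - s)) expR);
          last exact: continuous_expR.
        by apply: cvgMl_tmp; apply: cvgB; [exact: cvg_id|exact: cvg_cst].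
      exact: (cvg_comp _ _ (c1 z) (cP _)).
    apply: cvg_powR_ge0; rewrite ?dot_ge0//.
    - by move=> ?; exact: dot_ge0.
    - by rewrite (lt_le_trans ltr01).
    have c2 : {for z, continuous (fun z : Z => z.2.2 - z.2.1)}.
      exact: (cvgB (cy z) (cx z)).
    exact: (continuous_dot c2 c2).
  move=> z; apply: cvgB; last exact: (continuous_subspaceT C3').
  by apply: cvgB; [exact: C1'|exact: C2'].
have [||[t0 [x0 y0]]] := @compact_EVT_max _ R Psi _ _ _ cPsi.
- by exists (t1, (x1, y1)); split => //=; rewrite in_itv/= st1.
- by apply: compact_setX; [exact: segment_compact | apply: compact_setX; exact: compact_eball].
rewrite inE => -[]/=; rewrite in_itv/= => /andP[st0 t0T] [K0 K0'] mx.
have {}mx t x y : s <= t <= T -> K x -> K y -> Psi (t, (x, y)) <= Psi (t0, (x0, y0)).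
  by move=> t01 Kx Ky; apply: (mx (t, (x, y))); rewrite inE; split.
have v0 : 0 < Psi (t0, (x0, y0)) by apply: lt_le_trans v1 (mx _ _ _ _ Kx1 Ky1); rewrite st1.
have st0' : s < t0 <= T.
  rewrite t0T andbT lt_neqAle st0 andbT; apply/eqP => E.
  move: v0; rewrite /Psi/= -E /P subrr mulr0 expR0 mulr1.
  by rewrite ltNge subr_le0 init.
have mxx x y : Psi (t0, (x, y)) <= Psi (t0, (x0, y0)).
  have [/andP[Kx Ky]|] := boolP ((enorm x <= rad') && (enorm y <= rad')).
    by rewrite mx// st0.
  rewrite negb_and -!ltNge => H; rewrite (le_trans _ (ltW v0))//.
  rewrite /Psi/= subr_le0 coer ?st0//.
  by case/orP: H; rewrite gt_max => /andP[? _]; [left|right].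
have yx : y0 != x0.
  apply/eqP => E; move: v0; rewrite E /Psi/= subrr dot0l powR0; last first.
    by rewrite gt_eqF// (lt_le_trans ltr01).
  by rewrite mulr0 subr0 ltNge subr_le0 diag// st0.
have gen := generator_two_point_bound st0' (alB2 _ st0').1 (alB2 _ st0').2 (P0 t0) yx mxx.
have dal := derivableP (dalB t0 y0 st0').1.
have dB := derivableP (dalB t0 x0 st0').2.
have dP : is_derive t0 1 P (2 * a * kappa * P t0).
  have D1 : is_derive t0 1 (fun t => 2 * a * kappa * (t - s)) (2 * a * kappa).
    apply: is_derive_eq; rewrite /GRing.scale/=; ring.
  have D2 := is_deriveZ beta (is_derive1_comp (is_derive_expR _) D1).
  by apply: (is_derive_eq D2); rewrite /P /GRing.scale/=; ring.
have dk := is_deriveB (is_deriveB dal dB)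
  (is_deriveZ (dot (y0 - x0) (y0 - x0) `^ a) dP).
have := left_max_derive_ge0 dk (proj1 (andP st0')).
have := alA t0 y0 st0'; have := BA t0 x0 st0'; rewrite !derive1E => H1 H2 H.
suff : 0 <= 'D_1 (al^~ y0) t0 - 'D_1 (B^~ x0) t0 -
    dot (y0 - x0) (y0 - x0) `^ a * (2 * a * kappa * P t0).
  by move: gen H1 H2; lra.
apply: H => t /andP[st tt0].
have := mx t x0 y0; rewrite st (le_trans tt0)// => /(_ isT K0 K0').
by rewrite /Psi/= !(mulrC (P _)).
Qed.

End TwoPoint.

(** * Regularity of data and coefficients *)

Section Regularity.
Context {R : realType} {d : nat}.
Implicit Types (f g : 'rV[R]_d -> R) (x y h : 'rV[R]_d).

Lemma enormD x y : enorm (x + y) <= enorm x + enorm y.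
Proof.
rewrite -(@ler_pXn2r _ 2) ?nnegrE ?addr_ge0 ?enorm_ge0//.
rewrite sqrrD !sqr_enorm !dotE (dotC y x).
by have := dot_enorm x y; lra.
Qed.

Lemma pder_lin i f g (c : R) : C1 f -> C1 g ->
  pder i (fun x => f x + c * g x) = (fun x => pder i f x + c * pder i g x).
Proof.
move=> f1 g1; apply/funext => x.
have df := derivableP ((f1.2 i).1 x).
have dg := derivableP ((g1.2 i).1 x).
by have [_] := is_deriveD df (is_deriveZ c dg).
Qed.

Lemma C1_lin f g (c : R) : C1 f -> C1 g -> C1 (fun x => f x + c * g x).
Proof.
move=> f1 g1; split.
  by move=> x; exact: (cvgD (f1.1 x) (cvgMl_tmp (a := c) (g1.1 x))).
move=> i; split=> [x|].
  have df := derivableP ((f1.2 i).1 x).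
  have dg := derivableP ((g1.2 i).1 x).
  by have [] := is_deriveD df (is_deriveZ c dg).
rewrite pder_lin// => x.
exact: (cvgD ((f1.2 i).2 x) (cvgMl_tmp (a := c) ((g1.2 i).2 x))).
Qed.

Lemma C2_lin f g (c : R) : C2 f -> C2 g -> C2 (fun x => f x + c * g x).
Proof.
move=> [f1 f2] [g1 g2]; split; first exact: C1_lin.
by move=> i; rewrite (pder_lin i c f1 g1); exact: C1_lin (f2 i) (g2 i).
Qed.

Lemma pder_cst i (c : R) : pder i (fun _ : 'rV[R]_d => c) = (fun=> 0).
Proof. by apply/funext => x; exact: derive_cst. Qed.

Lemma C1_cst (c : R) : C1 (fun _ : 'rV[R]_d => c).
Proof.
split; first exact: cst_continuous.
move=> i; split; first by move=> x; case: (is_derive_cst c x (unit_vec R i)).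
by rewrite pder_cst; exact: cst_continuous.
Qed.

Lemma C2_cst (c : R) : C2 (fun _ : 'rV[R]_d => c).
Proof. by split => [|i]; rewrite ?pder_cst; exact: C1_cst. Qed.

Lemma opA_lin (q : R -> 'rV[R]_d -> 'M[R]_d) (b : R -> 'rV[R]_d -> 'rV[R]_d)
    t f g (c : R) x : C2 f -> C2 g ->
  opA q b t (fun x => f x + c * g x) x = opA q b t f x + c * opA q b t g x.
Proof.
move=> [f1 f2] [g1 g2].
rewrite /opA mulrDr [RHS]addrACA; congr (_ + _); rewrite !mulr_sumr -big_split/=.
  apply: eq_bigr => i _; rewrite mulr_sumr -big_split/=.
  apply: eq_bigr => j _; rewrite (pder_lin j c f1 g1) (pder_lin i c (f2 j) (g2 j)).
  by rewrite mulrDr (mulrCA _ c).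
by apply: eq_bigr => i _; rewrite (pder_lin i c f1 g1) mulrDr (mulrCA _ c).
Qed.

Lemma opA_cst (q : R -> 'rV[R]_d -> 'M[R]_d) (b : R -> 'rV[R]_d -> 'rV[R]_d)
    t (c : R) x : opA q b t (fun=> c) x = 0.
Proof.
rewrite /opA [X in X + _]big1 => [|i _]; last first.
  by apply: big1 => j _; rewrite !pder_cst mulr0.
by rewrite add0r big1// => i _; rewrite pder_cst mulr0.
Qed.

Lemma holder_continuous (I : set R) (alpha : R) (f : R -> 'rV[R]_d -> R) t :
  0 < alpha -> I t -> holder_loc I alpha f -> continuous (f t).
Proof.
move=> alpha0 It hf; suff H (x : 'rV[R]_d) : {for x, continuous (f t)} by move=> x; exact: H.
pose K := [set t] `*` [set y : 'rV[R]_d | enorm y <= enorm x + 1].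
have [|C HC] := hf K (compact_setX (@compact_set1 _ t) (@compact_eball _ _ _)).
  by move=> [u y] -[/= ut _]; split => //=; rewrite ut.
have c0 : pardist (t, x) (t, y) `^ alpha @[y --> x] --> enorm (x - x) `^ alpha.
  apply: (@cvg_powR_ge0 _ _ (nbhs x) _ (fun y => pardist (t, x) (t, y))) => //.
  - by move=> ?; rewrite addr_ge0 ?enorm_ge0 ?sqrtr_ge0.
  - exact: enorm_ge0.
  rewrite /pardist/= subrr normr0 sqrtr0; under eq_fun do rewrite addr0.
  have cB : {for x, continuous (fun y : 'rV[R]_d => x - y)}.
    by apply: (@cvgB _ _ _ (nbhs x) _ (fun=> x) id x x); [exact: cvg_cst|exact: cvg_id].
  exact: (cvg_comp _ _ cB (@continuous_enorm _ _ _)).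
have cC : C * pardist (t, x) (t, y) `^ alpha @[y --> x] --> (0 : R).
  have <- : C * enorm (x - x) `^ alpha = 0.
    by rewrite subrr /enorm dot0l sqrtr0 powR0 ?mulr0// gt_eqF.
  exact: cvgMl_tmp c0.
apply/(@cvgrPdist_lt _ R^o _ (nbhs x) _ (f t) (f t x)) => e e0; near=> y.
apply: le_lt_trans (HC (t, x) (t, y) _ _) _.
- by split => //=; rewrite lerDl.
- split => //=; near: y; apply: (@cvgr_le R); first exact: continuous_enorm.
  by rewrite ltrDl.
by near: y; apply: cvgr_lt cC _ _.
Unshelve. all: by end_near. Qed.

Lemma holder1_C1 (I : set R) (alpha : R) (f : R -> 'rV[R]_d -> R) t :
  0 < alpha -> I t -> holder1_loc I alpha f -> C1 (f t).
Proof.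
move=> alpha0 It [h0 h1]; split; first exact: holder_continuous h0.
by move=> i; split => [x|]; [exact: (h1 i).1 | exact: holder_continuous (h1 i).2].
Qed.

End Regularity.

Section Increment.
Context {R : realType} {d : nat}.
Implicit Types (f : 'rV[R]_d -> R) (x y h : 'rV[R]_d).

Lemma continuous_row (T : topologicalType) (g : T -> 'rV[R]_d) (z : T) :
  (forall i, {for z, continuous (fun t => g t 0 i)}) -> {for z, continuous g}.
Proof.
move=> cg U [P nP PU].
have H : \forall t \near z, forall i, P 0 i (g t 0 i).
  by apply: filter_forall => i; exact: cg (nP 0 i).
apply: filterS H => t Pt; apply: PU => i j; rewrite ord1; exact: Pt.
Qed.

Lemma continuous_grad f : C1 f -> continuous (grad f).
Proof.
move=> f1 x; apply: continuous_row => i.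
have -> : (fun t => grad f t 0 i) = pder i f by apply/funext => y; rewrite mxE.
exact: (f1.2 i).2.
Qed.

Lemma bounded_fun_ex (T : Type) (g : T -> R) :
  bounded_fun g -> exists2 M, 0 <= M & forall t, `|g t| <= M.
Proof.
move=> [M [_ HM]]; have Mlt : M < `|M| + 1 by rewrite (le_lt_trans (ler_norm M))// ltrDl.
by exists (`|M| + 1) => [|x]; [rewrite addr_ge0 | exact: (HM _ Mlt)].
Qed.

Lemma C1b_C1 f : C1b f -> C1 f.
Proof. by case. Qed.

Lemma C1b_grad_bound f : C1b f -> exists2 L : R, 0 <= L & forall x, enorm (grad f x) <= L.
Proof.
move=> [_ _ bf].
have /choice[M HM] : forall i, exists M : R, forall x, `|pder i f x| <= M.
  by move=> i; have [M _ HM] := bounded_fun_ex (bf i); exists M.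
exists (Num.sqrt (\sum_i M i ^+ 2)); first exact: sqrtr_ge0.
move=> x; rewrite ler_wsqrtr// /dot ler_sum// => i _; rewrite mxE -expr2.
by rewrite -real_normK ?num_real// lerXn2r ?nnegrE// (le_trans _ (HM i x)).
Qed.

(* The Lyapunov function absorbs the lack of uniformity at infinity of the first
   order expansion of f, so that one e works for all x and h. *)
Lemma near_increment_le f (psi phi : 'rV[R]_d -> R) (beta a delta : R) :
  C1b f -> continuous psi -> (forall x, 0 <= psi x) ->
  (forall x, 1 <= phi x) -> (forall M, exists rad, forall x, rad < enorm x -> M < phi x) ->
  0 < beta -> 1 <= a -> 0 < delta ->
  (forall x h, dot h (grad f x) <= psi x + beta * dot h h `^ a) ->
  \forall e \near (0 : R)^'+, forall x h,
    f (x + e *: h) - f x <= e * (psi x + delta * phi x + beta * dot h h `^ a).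
Proof.
move=> fb cpsi psi0 phi1 phioo beta0 a1 delta0 fpsi.
have f1 : C1 f by case: fb.
have a0 : 0 < a by rewrite (lt_le_trans ltr01).
have [L L0 HL] := C1b_grad_bound fb.
(* For |h| > H one has L <= beta |h|, so L |h| is at most beta |h|^(2a). For the remaining h, [rho]
   is chosen so that delta phi exceeds L H >= L |h| when |x| > rho. *)
pose H := 1 + L / beta.
have [rho Hrho] := phioo (L * H / delta).
pose K := [set x : 'rV[R]_d | enorm x <= rho] `*` [set h : 'rV[R]_d | enorm h <= H].
have cK : compact K by apply: compact_setX; exact: compact_eball.
pose Phi (z : ('rV[R]_d * 'rV[R]_d) * R) := dot z.1.2 (grad f (z.1.1 + z.2 *: z.1.2))
   - psi z.1.1 - beta * dot z.1.2 z.1.2 `^ a.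
have cPhi : continuous Phi.
  move=> z; pose Z := (('rV[R]_d * 'rV[R]_d) * R)%type.
  have cid : {for z, continuous (fun z' : Z => z')} by exact: cvg_id.
  have cx := continuous_for_fst (continuous_for_fst cid).
  have ch := continuous_for_snd (continuous_for_fst cid).
  have ce := continuous_for_snd cid.
  have cp : {for z, continuous (fun z : Z => z.1.1 + z.2 *: z.1.2)}.
    exact: (cvgD cx (cvgZ ce ch)).
  apply: cvgB; first apply: cvgB.
  - exact: (continuous_dot ch (cvg_comp _ _ cp (@continuous_grad f f1 _))).
  - exact: (cvg_comp _ _ cx (cpsi _)).
  - apply: cvgMl_tmp; apply: cvg_powR_ge0 => //; [by move=> ?; exact: dot_ge0|exact: dot_ge0|].
    exact: (continuous_dot ch ch).
(* At parameter 0 the value is at most 0 by [fpsi]; compactness makes the bound by [delta] uniform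
   for small parameters. *)
have near_K : \forall e \near (0 : R), K `<=` (fun z => Phi (z, e) < delta).
  have /compact_near_coveringP/(_ R (nbhs (0 : R))) := cK; apply.
  move=> z _.
  have z0 : Phi (z, 0) < delta.
    rewrite /Phi/= scale0r addr0 (le_lt_trans _ delta0)//.
    by have := fpsi z.1 z.2; lra.
  exact: (@cvgr_lt _ _ _ _ _ _ (cPhi (z, 0)) _ z0).
have [e0 /= e00 He0] : exists2 e : R, 0 < e &
    forall c, `|c| < e -> K `<=` (fun z => Phi (z, c) < delta).
  have /nbhs_ballP[e /= e0 He] := near_K.
  by exists e => // c ce; apply: He; rewrite /ball/= sub0r normrN.
near=> e => x h.
have ep : 0 < e by near: e; exact: nbhs_right_gt.
have ee0 : e < e0 by near: e; exact: nbhs_right_lt.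
have [c|c|c] := @MVT R (fun r => f (x + r *: h))
  (fun r => dot h (grad f (x + r *: h))) 0 e ep.
- by move=> _; exact: C1_line.
- by apply: continuous_subspaceT => r; exact: is_derive_continuous (C1_line x h r f1).
rewrite in_itv/= => /andP[cp ce] E.
move: E; rewrite scale0r addr0 subr0 => ->; rewrite mulrC ler_pM2l//.
have dphi : delta <= delta * phi x by rewrite ler_pMr.
have [hH|hH] := leP (enorm h) H; last first.
  have H1 : 1 <= H by rewrite lerDl divr_ge0// ltW.
  have h1 : 1 <= enorm h by rewrite (le_trans H1)// ltW.
  have h2 : enorm h ^+ 2 <= dot h h `^ a.
    by rewrite sqr_enorm le1r_powR// -sqr_enorm exprn_ege1.
  have h3 : L <= beta * enorm h.
    rewrite mulrC -ler_pdivrMr// (le_trans _ (ltW hH))// /H lerDr//.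
  have h4 : enorm h * enorm (grad f (x + c *: h)) <= enorm h * (beta * enorm h).
    by rewrite ler_wpM2l ?enorm_ge0// (le_trans (HL _)).
  have h5 : beta * enorm h ^+ 2 <= beta * dot h h `^ a by rewrite ler_pM2l.
  apply: le_trans (dot_enorm _ _) (le_trans h4 _).
  by have := psi0 x; move: h5; rewrite expr2; lra.
have [xr|xr] := leP (enorm x) rho.
  have := He0 c _ (x, h) (conj xr hH); rewrite /Phi/= gtr0_norm// (lt_trans ce)// => /(_ isT).
  lra.
have := Hrho x xr; rewrite ltr_pdivrMr// => H1.
apply: le_trans (dot_enorm _ _) _.
have : enorm h * enorm (grad f (x + c *: h)) <= H * L by rewrite ler_pM ?enorm_ge0.
have : 0 <= beta * dot h h `^ a by rewrite mulr_ge0 ?powR_ge0// ltW.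
by have := psi0 x; lra.
Unshelve. all: by end_near. Qed.

End Increment.

(** * Conjugate exponents and limits of powers *)

Section Young.
Context {R : realType}.
Implicit Types (p x y w : R).

(* The constant makes [x ^ p] exactly the Legendre transform of [beta * y ^ q]. *)
Lemma young_duality p : 1 < p -> let q := p / (p - 1) in exists2 beta : R, 0 < beta &
  (forall x y, 0 <= x -> 0 <= y -> x * y <= x `^ p + beta * y `^ q) /\
  (forall x w, 0 <= x -> (forall y, 0 <= y -> x * y <= w + beta * y `^ q) ->
     x `^ p <= w).
Proof.
move=> p1 q.
have p0 : 0 < p by rewrite (lt_trans ltr01).
have pm : 0 < p - 1 by rewrite subr_gt0.
have q0 : 0 < q by rewrite divr_gt0.
have qp : p^-1 + q^-1 = 1 by rewrite /q; field; rewrite !gt_eqF.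
exists (p `^ (- (q / p)) / q); first by rewrite divr_gt0// powR_gt0.
split=> [x y x0 y0|x w x0 H].
  (* Scaling by p^(1/p) cancels the coefficient 1/p of x^p and moves the constant into [beta]. *)
  have := @conjugate_powR R (p `^ p^-1 * x) (p `^ (- p^-1) * y) p q.
  rewrite !mulr_ge0 ?powR_ge0// => /(_ isT isT p0 q0 qp).
  rewrite !powRM ?powR_ge0// -!powRrM mulVf ?gt_eqF// powRr1 ?(ltW p0)//.
  have -> : p `^ p^-1 * x * (p `^ (- p^-1) * y) =
      p `^ p^-1 * p `^ (- p^-1) * (x * y) by ring.
  rewrite -powRD ?subrr ?powRr0 ?mul1r ?(gt_eqF p0) ?implybT//.
  have -> : - p^-1 * q = - (q / p) by rewrite mulNr mulrC.
  by rewrite [p * _]mulrC mulfK ?gt_eqF// mulrAC.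
(* The slope of the power at [x], where Young's inequality is an equality. *)
have y0 : 0 <= p * x `^ (p - 1) by rewrite mulr_ge0 ?powR_ge0// ltW.
have := H _ y0.
rewrite powRM ?powR_ge0 ?(ltW p0)// -powRrM.
have -> : (p - 1) * q = p by rewrite /q mulrC divfK ?gt_eqF.
have -> : x * (p * x `^ (p - 1)) = p * x `^ p by rewrite mulrCA mulr_powRB1.
have -> : p `^ (- (q / p)) / q * (p `^ q * x `^ p) =
   p `^ (- (q / p)) * p `^ q / q * x `^ p by ring.
rewrite -powRD; last by rewrite (gt_eqF p0) implybT.
have -> : - (q / p) + q = 1 by rewrite /q; field; rewrite !gt_eqF.
rewrite powRr1 ?(ltW p0)//.
have -> : p / q = p - 1 by rewrite /q invf_div mulrC divfK ?gt_eqF.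
lra.
Qed.

(** As a function of X = x^p, x^2 is concave; the right side is its tangent at X = y^p. Being affine
    in x^p, it is a bound that a linear evolution preserves. *)
Lemma sqr_le_tangent p x y : 2 < p -> 0 <= x -> 0 < y ->
  x `^ 2 <= 2 / p * (y ^+ 2 / y `^ p) * x `^ p + (1 - 2 / p) * y ^+ 2.
Proof.
move=> p2 x0 y0; have p0 : 0 < p by rewrite (lt_trans _ p2).
have pm : 0 < p - 2 by rewrite subr_gt0.
have yp : 0 < y `^ p by rewrite powR_gt0.
have := @conjugate_powR R ((x / y) ^+ 2) 1 (p / 2) (p / (p - 2)).
rewrite sqr_ge0 ler01 !divr_gt0// => /(_ isT isT isT isT).
have -> : (p / 2)^-1 + (p / (p - 2))^-1 = 1 by field; rewrite !gt_eqF.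
move=> /(_ erefl); rewrite mulr1 powR1.
have -> : ((x / y) ^+ 2) `^ (p / 2) = x `^ p / y `^ p.
  rewrite -powR_mulrn ?divr_ge0 ?(ltW y0)// -powRrM mulrCA mulfV ?mulr1//.
  by rewrite powRM ?invr_ge0 ?(ltW y0)// -powR_inv1 ?(ltW y0)// -powRrM mulN1r powRN.
rewrite powR_mulrn// expr_div_n ler_pdivrMr ?exprn_gt0// => H; apply: (le_trans H).
rewrite le_eqVlt; apply/orP; left; apply/eqP; field.
by rewrite !gt_eqF.
Qed.

(** After division by y^e, (x / y)^e is at least 1 + e ln(x / y), and e may be taken small. *)
Lemma powR_limit_one x y w : 0 < x -> 0 < y ->
  (forall e, 0 < e <= 1 -> x * x `^ e <= y `^ e * w) -> x <= w.
Proof.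
move=> x0 y0 H; pose l := ln (x / y).
have xy : 0 < x / y by rewrite divr_gt0.
have K e : 0 < e <= 1 -> x * (1 + e * l) <= w.
  move=> e01; have ye : 0 < y `^ e by rewrite powR_gt0.
  have := H e e01; rewrite mulrC -[leRHS]mulrC -ler_pdivrMr//.
  apply: le_trans.
  rewrite -mulrA [leRHS]mulrC -mulrA ler_pM2l//.
  have -> : (y `^ e)^-1 * x `^ e = expR (e * l).
    rewrite mulrC -powRN -[- e]mulN1r powRrM powR_inv1 ?(ltW y0)//.
    rewrite -powRM ?invr_ge0 ?(ltW x0) ?(ltW y0)//.
    by rewrite /powR gt_eqF.
  exact: expR_ge1Dx.
apply/ler_addgt0Pr => z z0.
have D : 0 < x * `|l| + z by rewrite ltr_wpDl// mulr_ge0// ltW.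
(* With this exponent e, the error x e |l| is at most z. *)
have e01 : 0 < z / (x * `|l| + z) <= 1.
  by rewrite divr_gt0//= ler_pdivrMr// mul1r lerDr mulr_ge0// ltW.
have := K _ e01.
have : z / (x * `|l| + z) * (x * `|l|) <= z.
  rewrite mulrAC ler_pdivrMr// ler_wpM2l ?(ltW z0)// lerDl ltW//.
have : - (z / (x * `|l| + z) * (x * `|l|)) <= x * (z / (x * `|l| + z) * l).
  rewrite -mulrN -mulrN (mulrCA x) ler_wpM2l//; first by case/andP: e01 => /ltW.
  by rewrite ler_wpM2l ?(ltW x0)// lerNl -normrN ler_norm.
lra.
Qed.

End Young.

(** * Estimates for the evolution operator *)

Section Evolution.
Context {R : realType} {d : nat}.
Variables (I : set R) (alpha : R).
Variables (q : R -> 'rV[R]_d -> 'M[R]_d) (b : R -> 'rV[R]_d -> 'rV[R]_d).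
Variables (eta : R -> 'rV[R]_d -> R).
Hypothesis I_halfline : R_or_right_halfline I.
Hypothesis alpha01 : 0 < alpha < 1.
Hypothesis coef_reg : regular_coefficients q b I alpha.
Hypothesis ellipt : uniformly_elliptic q I eta.
Hypothesis lyap : has_lyapunov q b I.

Lemma I_convex (s T t : R) : I s -> s <= t -> I t.
Proof.
case: I_halfline => [->//|[a [->|->]]] /=; rewrite !in_itv/= !andbT => H1 H2.
  exact: lt_le_trans H2.
exact: le_trans H2.
Qed.

Lemma elliptic_gt0 t x : I t -> 0 < eta t x.
Proof.
move=> It; have [_ i0 _] := ellipt.
set S := [set _ | _ in _] in i0.
have Sx : S (eta t x) by exists (t, x).
(* Without a lower bound [inf] would take its default value 0, against [i0]. *)
have [hS|/inf_out E] := pselect (has_inf S); last by rewrite E ltxx in i0.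
by apply: lt_le_trans i0 _; apply: ge_inf => //; case: hS.
Qed.

Lemma elliptic_form t x v : I t -> eta t x * dot v v <= dot (v *m q t x) v.
Proof.
move=> It; have [sq _ /(_ t x v It)] := ellipt.
by rewrite /qform sq// sqr_enorm.
Qed.

Lemma elliptic_pos t x v : I t -> v != 0 -> 0 < dot (v *m q t x) v.
Proof.
move=> It v0; apply: lt_le_trans (elliptic_form x v It).
by rewrite mulr_gt0 ?elliptic_gt0 ?dot_gt0.
Qed.

(** The operator kills constants, so the Lyapunov function, bounded below by compactness and growth,
    can be raised above 1; increasing the rate by 1 then makes the inequality strict. *)
Lemma lyapunov_ge1 (s T : R) : I s -> s <= T ->
  exists (phi : 'rV[R]_d -> R) (mu : R),
  [/\ C2 phi, 0 < mu, forall x, 1 <= phi x,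
    forall M, exists rad, forall x, rad < enorm x -> M < phi x &
    forall t x, s <= t <= T -> opA q b t phi x < mu * phi x].
Proof.
move=> Is sT.
have [|||phi [la [phi2 la0 phioo phiA]]] := lyap (J := `[s, T]%classic).
- exact: interval_is_interval.
- exact: compact_bounded (@segment_compact _ _ _).
- by move=> t /=; rewrite in_itv/= => /andP[st _]; exact: I_convex st.
have [rad Hrad] := phioo 0.
have [m Hm] : exists m, forall x, m <= phi x.
  have [||x0 _ Hx0] := @compact_EVT_min _ R phi _ _ (@compact_eball R d (Num.max rad 0)).
  - by exists 0; rewrite /= /enorm dot0l sqrtr0 le_max lexx orbT.
  - by apply: continuous_subspaceT; case: phi2 => -[].
  exists (Num.min 0 (phi x0)) => x; rewrite ge_min.
  have [xr|xr] := leP (enorm x) (Num.max rad 0).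
    by rewrite Hx0 ?orbT// inE.
  by move: xr; rewrite gt_max => /andP[/Hrad/ltW -> _].
pose k : R := 1 + `|m|.
have k0 : 0 <= k by rewrite addr_ge0.
exists (fun x => phi x + 1 * k), (la + 1).
have phi1 x : 1 <= phi x + 1 * k.
  by rewrite mul1r /k; have := Hm x; have := ler_norm (- m); rewrite normrN; lra.
split.
- by apply: C2_lin phi2 _; exact: C2_cst.
- by rewrite addr_gt0.
- exact: phi1.
- by move=> M; have [r Hr] := phioo M; exists r => x /Hr; rewrite mul1r; lra.
move=> t x stT; rewrite (opA_lin _ _ _ _ _ phi2 (C2_cst k)).
rewrite opA_cst mulr0 addr0 mulrDl mul1r.
have : opA q b t phi x <= la * phi x.
  by rewrite -subr_le0; apply: phiA; rewrite /= in_itv.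
have : 0 <= la * k by rewrite mulr_ge0// ltW.
by have := phi1 x; rewrite mul1r => ? ? ?; rewrite mulrDr; lra.
Qed.

Section Solution.
Variables (s : R) (f : 'rV[R]_d -> R) (u : R -> 'rV[R]_d -> R).
Hypothesis sol : bounded_classical_solution q b s f u.

Lemma sol_within T : {within `[s, T]%classic `*` [set: 'rV[R]_d],
  continuous (fun z : R * 'rV[R]_d => u z.1 z.2)}.
Proof.
have [cu _ _ _ _] := sol; apply: continuous_subspaceW cu => -[t x] [/=].
by rewrite in_itv/= => /andP[].
Qed.

Lemma sol_bounded : exists2 M, 0 <= M & forall t x, s <= t -> `|u t x| <= M.
Proof.
have [_ [M [_ HM]] _ _ _] := sol.
have Mlt : M < `|M| + 1 by rewrite (le_lt_trans (ler_norm M))// ltrDl.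
exists (`|M| + 1) => [|t x st]; first by rewrite addr_ge0.
exact: (HM _ Mlt (t, x)).
Qed.

Lemma slice_continuous (g : R * 'rV[R]_d -> R) t :
  (forall x, {for (t, x), continuous g}) -> continuous (fun x => g (t, x)).
Proof.
move=> cg x.
have cx : {for x, continuous (fun y : 'rV[R]_d => (t, y))}.
  by apply: continuous_for_pair; [exact: cst_continuous|exact: cvg_id].
exact: (cvg_comp _ _ cx (cg x)).
Qed.

Lemma sol_continuous t : s <= t -> continuous (u t).
Proof.
move=> st; have [/subspace_continuousP cu _ _ _ _] := sol => x.
have := cu (t, x) st => c U /c; rewrite /nbhs/= => -[[P1 P2] /= [n1 n2] HP].
apply: filterS n2 => y P2y; apply: (HP (t, y)) => //; split => //.
exact: nbhs_singleton n1.
Qed.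

Lemma sol_C2 t : s < t -> C2 (u t).
Proof.
move=> st; have [_ _ [du _ cp cpp] _ _] := sol.
have p1 i : continuous (pder i (u t)).
  by apply: (@slice_continuous (fun z => pder i (u z.1) z.2)) => x; exact: cp.
split; first split.
- exact/sol_continuous/ltW.
- by move=> i; split=> [x|//]; have [_ /(_ i)] := du t x st.
move=> i; split=> // j; split=> [x|].
  by have [_ _ /(_ j i)] := du t x st.
by apply: (@slice_continuous (fun z => pder j (pder i (u z.1)) z.2)) => x; exact: cpp.
Qed.

Lemma sol_is_derive t x : s < t -> is_derive t 1 (u^~ x) (opA q b t (u t) x).
Proof.
move=> st; have [_ _ [du _ _ _] eu _] := sol.
by rewrite -eu// derive1E; apply/derivableP; have [] := du t x st.
Qed.

Lemma sol_init x : u s x = f x.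
Proof. by have [] := sol. Qed.

End Solution.

Lemma is_derive_weight (k mu s t : R) :
  is_derive t 1 (fun r : R => k * expR (mu * (r - s))) (mu * (k * expR (mu * (t - s)))).
Proof.
have D1 : is_derive t 1 (fun r : R => mu * (r - s)) mu.
  by apply: is_derive_eq; rewrite /GRing.scale/=; ring.
have D2 := is_deriveZ k (is_derive1_comp (is_derive_expR _) D1).
by apply: (is_derive_eq D2); rewrite /GRing.scale/=; ring.
Qed.

Lemma continuous_weight (k mu s T : R) (phi : 'rV[R]_d -> R) : continuous phi ->
  {within `[s, T]%classic `*` [set: 'rV[R]_d],
    continuous (fun z : R * 'rV[R]_d => k * expR (mu * (z.1 - s)) * phi z.2)}.
Proof.
move=> cphi; apply: continuous_subspaceT => z.
have cid : {for z, continuous (fun z' : R * 'rV[R]_d => z')} by exact: cvg_id.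
have c1 := continuous_for_fst cid.
have c2 := continuous_for_snd cid.
have ck : {for z.1, continuous (fun r : R => k * expR (mu * (r - s)))}.
  exact: is_derive_continuous (is_derive_weight _ _ _ _).
apply: cvgM; first exact: (cvg_comp _ _ c1 ck).
exact: (cvg_comp _ _ c2 (cphi _)).
Qed.

Lemma weight_ge1 (mu s t : R) : 0 < mu -> s <= t -> 1 <= expR (mu * (t - s)).
Proof.
move=> mu0 st; rewrite -expR0 ler_expR mulr_ge0 ?(ltW mu0)// subr_ge0//.
Qed.

(** The affine form covers positivity, tangent bounds and rescaled data at once. Subtracting de
    exp(mu (t-s)) phi gives strictness and negativity at infinity; finally [de] tends to 0. *)
Lemma solution_comparison (s T : R) f1 f2 u1 u2 (a1 a2 c : R) : I s -> s <= T ->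
  bounded_classical_solution q b s f1 u1 -> bounded_classical_solution q b s f2 u2 ->
  (forall x, a1 * f1 x <= a2 * f2 x + c) ->
  forall x, a1 * u1 T x <= a2 * u2 T x + c.
Proof.
move=> Is sT sol1 sol2 f12 x1.
have [phi [mu [phi2 mu0 phi1 phioo phiA]]] := lyapunov_ge1 Is sT.
have Ip t : s < t <= T -> I t by move=> /andP[/ltW st _]; exact: I_convex st.
have [M1 M10 HM1] := sol_bounded sol1.
have [M2 M20 HM2] := sol_bounded sol2.
suff main (de : R) : 0 < de ->
    a1 * u1 T x1 <= a2 * u2 T x1 + c + de * (expR (mu * (T - s)) * phi x1).
  apply/ler_addgt0Pr => e e0.
  have E0 : 0 < expR (mu * (T - s)) * phi x1.
    by rewrite mulr_gt0 ?expR_gt0// (lt_le_trans ltr01).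
  apply: le_trans (main (e / (expR (mu * (T - s)) * phi x1)) _) _.
    by rewrite divr_gt0.
  by rewrite divfK ?gt_eqF.
move=> de0.
pose w t := - de * expR (mu * (t - s)).
pose v t := fun x => ((fun=> - c) x + a1 * u1 t x + (- a2) * u2 t x) + w t * phi x.
have C2v t : s < t -> C2 (fun x => (fun=> - c) x + a1 * u1 t x + (- a2) * u2 t x).
  move=> st.
  exact: (C2_lin (- a2) (C2_lin a1 (C2_cst (- c)) (sol_C2 sol1 st)) (sol_C2 sol2 st)).
have vD t x (st : s < t) : is_derive t 1 (v^~ x)
    (- c * 0 + a1 * opA q b t (u1 t) x + - a2 * opA q b t (u2 t) x +
     phi x * (mu * w t)).
  have D := is_deriveD (is_deriveD (is_deriveD (is_derive_cst (- c) t (1 : R))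
     (is_deriveZ a1 (sol_is_derive sol1 x st)))
     (is_deriveZ (- a2) (sol_is_derive sol2 x st)))
     (is_deriveZ (phi x) (is_derive_weight (- de) mu s t)).
  have -> : v^~ x = cst (- c) + a1 \*: (u1^~ x) + (- a2) \*: (u2^~ x) +
      phi x \*: (fun r : R => - de * expR (mu * (r - s))).
    by apply/funext => r; rewrite /v /w [X in _ + X]mulrC.
  by apply: (is_derive_eq D); rewrite mulr0.
have [rad Hrad] := phioo ((`|c| + `|a1| * M1 + `|a2| * M2) / de).
suff : v T x1 <= 0 by rewrite /v /w; lra.
apply: (@one_point_max R d q b s T _ _ v rad); last by rewrite sT lexx.
- by move=> t x st; have [sq _ _] := ellipt; rewrite sq//; exact: Ip.
- by move=> t x y st; apply: elliptic_pos; exact: Ip.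
- have W1 := sol_within sol1 (T := T); have W2 := sol_within sol2 (T := T).
  have W3 := @continuous_weight (- de) mu s T phi phi2.1.1.
  move=> z; rewrite /v.
  apply: cvgD; last exact: W3.
  apply: cvgD; last by apply: cvgMl_tmp; exact: W2.
  apply: cvgD; last by apply: cvgMl_tmp; exact: W1.
  exact: cvg_cst.
- by move=> t /andP[st tT]; exact: (C2_lin (w t) (C2v t st) phi2).
- by move=> t x /andP[st _]; case: (vD t x st).
- move=> t x /andP[st tT]; have [_ Dv] := vD t x st.
  rewrite derive1E Dv.
  rewrite (opA_lin _ _ _ _ _ (C2v t st) phi2).
  rewrite (opA_lin _ _ _ _ _ (C2_lin a1 (C2_cst (- c)) (sol_C2 sol1 st)) (sol_C2 sol2 st)).
  rewrite (opA_lin _ _ _ _ _ (C2_cst (- c)) (sol_C2 sol1 st)) opA_cst add0r.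
  have wneg : w t < 0 by rewrite /w mulNr oppr_lt0 mulr_gt0 ?expR_gt0.
  rewrite mulr0 add0r ltrD2l (mulrC (phi x)) (mulrC mu) -mulrA ltr_nM2l//.
  by apply: phiA; rewrite (ltW st).
- move=> t x /andP[st tT] xr.
  have : de * phi x <= de * expR (mu * (t - s)) * phi x.
    rewrite ler_wpM2r ?(le_trans ler01)// ler_peMr ?(ltW de0)// weight_ge1//.
  have := Hrad x xr; rewrite ltr_pdivrMr// mulrC => H.
  have := ler_norm (- c); rewrite normrN.
  have B1 : a1 * u1 t x <= `|a1| * M1.
    by rewrite (le_trans (ler_norm _))// normrM ler_wpM2l// HM1.
  have B2 : - a2 * u2 t x <= `|a2| * M2.
    by rewrite (le_trans (ler_norm _))// normrM normrN ler_wpM2l// HM2.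
  by rewrite /v /w mulNr; lra.
- move=> x; rewrite /v /w (sol_init sol1) (sol_init sol2) subrr mulr0 expR0 mulr1.
  have : 0 <= de * phi x by rewrite mulr_ge0 ?(ltW de0)// (le_trans ler01).
  by have := f12 x; lra.
Qed.

Section GradientBound.
Variables (m r : R -> 'rV[R]_d -> R) (a kappa : R).
Hypothesis a_ge1 : 1 <= a.
Hypothesis dq_bound : forall t x i j k, I t ->
  pder k (fun y => q t y i j) x ^+ 2 <= m t x * eta t x.
Hypothesis jac_bound : jac_bounded_by I b r.
Hypothesis kappa_bound : forall t x, I t ->
  r t x + (2 * a - 1) * (d%:R ^+ 3 * m t x / 4) <= kappa.
Variables (s T : R) (f psi : 'rV[R]_d -> R) (u w : R -> 'rV[R]_d -> R) (beta : R).
Hypotheses (Is : I s) (sT : s < T) (fb : C1b f) (cpsi : continuous psi).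
Hypothesis psi_ge0 : forall x, 0 <= psi x.
Hypothesis solu : bounded_classical_solution q b s f u.
Hypothesis solw : bounded_classical_solution q b s psi w.
Hypothesis beta_gt0 : 0 < beta.
Hypothesis f_psi : forall x h, dot h (grad f x) <= psi x + beta * dot h h `^ a.

Let w_ge0 t x : s <= t -> 0 <= w t x.
Proof.
move=> st; have := @solution_comparison s t psi psi w w 0 1 0 Is st solw solw _ x.
by rewrite mul0r mul1r addr0; apply => y; rewrite mul0r mul1r addr0.
Qed.

(** Here [two_point_max] compares [u] with [B], the sum of u, e w and a Lyapunov term: positivity of
    the additions gives the diagonal condition, and the Lyapunov term makes [B] a strict
    supersolution. The initial condition is the hypothesis on [f] with h = (y - x) / e. *)
Lemma increment_bound phi mu de e :
  C2 phi -> 0 < mu -> (forall x, 1 <= phi x) ->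
  (forall M, exists rad, forall x, rad < enorm x -> M < phi x) ->
  (forall t x, s <= t <= T -> opA q b t phi x < mu * phi x) ->
  0 < de -> 0 < e ->
  (forall x h, f (x + e *: h) - f x <= e * (psi x + de * phi x + beta * dot h h `^ a)) ->
  forall x h, u T (x + e *: h) - u T x <=
    e * (w T x + de * expR (mu * (T - s)) * phi x +
         beta * expR (2 * a * kappa * (T - s)) * dot h h `^ a).
Proof.
move=> phi2 mu0 phi1 phioo phiA de0 e0 incr x0 h0.
have Ip t : s < t <= T -> I t by move=> /andP[/ltW st _]; exact: I_convex st.
have [M M0 HM] := sol_bounded solu.
pose W t := e * de * expR (mu * (t - s)).
pose B t := fun x => (u t x + e * w t x) + W t * phi x.
have ed0 : 0 < e * de by rewrite mulr_gt0.
have e2 : 0 < (e ^+ 2) `^ a by rewrite powR_gt0// exprn_gt0.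
(* Chosen so that the penalty at y - x = e h equals e beta |h|^(2a). *)
pose beta' := e * beta / (e ^+ 2) `^ a.
have beta'0 : 0 < beta' by rewrite divr_gt0// mulr_gt0.
have scaleE (h : 'rV[R]_d) : beta' * dot (e *: h) (e *: h) `^ a = e * beta * dot h h `^ a.
  rewrite dotZl dotZr mulrA -expr2 powRM ?sqr_ge0 ?dot_ge0//.
  by rewrite /beta' mulrA divfK// gt_eqF.
have C2uw t : s < t -> C2 (fun x => u t x + e * w t x).
  by move=> st; exact: (C2_lin e (sol_C2 solu st) (sol_C2 solw st)).
have C2B t : s < t -> C2 (B t).
  by move=> st; exact: (C2_lin (W t) (C2uw t st) phi2).
have BD t x (st : s < t) : is_derive t 1 (B^~ x)
    (opA q b t (u t) x + e * opA q b t (w t) x + phi x * (mu * W t)).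
  have D := is_deriveD (is_deriveD (sol_is_derive solu x st)
     (is_deriveZ e (sol_is_derive solw x st)))
     (is_deriveZ (phi x) (is_derive_weight (e * de) mu s t)).
  have -> : B^~ x = (u^~ x) + e \*: (w^~ x) +
      phi x \*: (fun r : R => e * de * expR (mu * (r - s))).
    by apply/funext => z; rewrite /B /W [X in _ + X]mulrC.
  exact: D.
(* [kappa] may be negative, so the weight may decay; [pmin] bounds it from below on [s, T]. *)
pose pmin := beta' * expR (- `|2 * a * kappa| * (T - s)).
have pmin0 : 0 < pmin by rewrite mulr_gt0// expR_gt0.
have Pmin t : s <= t <= T -> pmin <= beta' * expR (2 * a * kappa * (t - s)).
  move=> /andP[st tT]; rewrite ler_pM2l// ler_expR.
  apply: (@le_trans _ _ (- `|2 * a * kappa| * (t - s))).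
    by rewrite !mulNr lerN2 ler_wpM2l// lerD2r.
  by rewrite ler_wpM2r ?subr_ge0// lerNl -normrN ler_norm.
have W_ge t : s <= t -> e * de <= W t.
  by move=> st; rewrite /W ler_peMr ?(ltW ed0)// weight_ge1.
have [rad1 Hrad1] := phioo (2 * M / (e * de)).
(* At distance at least [ell] the penalty exceeds the oscillation 2 M of [u]; the summand 1 makes
   |y-x|^(2a) at least |y-x|. *)
pose ell := 1 + 2 * M / pmin.
have BE : B T x0 = u T x0 + e * w T x0 + W T * phi x0 by [].
suff H : u T (x0 + e *: h0) - B T x0 <= beta' * expR (2 * a * kappa * (T - s)) *
    dot (x0 + e *: h0 - x0) (x0 + e *: h0 - x0) `^ a.
  move: H; rewrite (addrC x0) addrK mulrAC scaleE BE /W.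
  have -> : e * (w T x0 + de * expR (mu * (T - s)) * phi x0 +
     beta * expR (2 * a * kappa * (T - s)) * dot h0 h0 `^ a) =
     e * w T x0 + e * de * expR (mu * (T - s)) * phi x0 +
     e * beta * dot h0 h0 `^ a * expR (2 * a * kappa * (T - s)) by ring.
  lra.
apply: (@two_point_max R d q b eta m r s T a kappa _ _ _ _ _ _ _ _ _
  u B beta' (`|rad1| + ell)).
- by move=> t x st; have [sq _ _] := ellipt; rewrite sq//; exact: Ip.
- move=> t i j st; have [qr _] := coef_reg.
  by apply: (holder1_C1 _ (Ip t st) (qr i j)); case/andP: alpha01.
- move=> t i st; have [_ br] := coef_reg.
  by apply: (holder1_C1 _ (Ip t st) (br i)); case/andP: alpha01.
- by move=> t x st; apply: elliptic_gt0; exact: Ip.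
- by move=> t x v st; apply: elliptic_form; exact: Ip.
- by move=> t x i j k st; apply: dq_bound; exact: Ip.
- by move=> t x v st; rewrite -sqr_enorm; apply: jac_bound; exact: Ip.
- exact: a_ge1.
- by move=> t x st; apply: kappa_bound; exact: Ip.
- exact: beta'0.
- by have W1 := sol_within solu (T := T); exact: W1.
- have W1 := sol_within solu (T := T); have W2 := sol_within solw (T := T).
  have W3 := @continuous_weight (e * de) mu s T phi phi2.1.1.
  move=> z; apply: cvgD; last exact: W3.
  by apply: cvgD; [exact: W1 | apply: cvgMl_tmp; exact: W2].
- by move=> t /andP[st _]; split; [exact: (sol_C2 solu st) | exact: C2B].
- move=> t x /andP[st _]; split; first by case: (sol_is_derive solu x st).
  by case: (BD t x st).
- by move=> t x /andP[st _]; have [_] := sol_is_derive solu x st; rewrite derive1E => ->.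
- move=> t x /andP[st tT]; have [_ Dv] := BD t x st; rewrite derive1E Dv.
  rewrite (opA_lin _ _ _ _ _ (C2uw t st) phi2).
  rewrite (opA_lin _ _ _ _ _ (sol_C2 solu st) (sol_C2 solw st)).
  have Wp : 0 < W t by rewrite (lt_le_trans ed0)// W_ge// ltW.
  have -> : phi x * (mu * W t) = W t * (mu * phi x) by ring.
  rewrite ltrD2l ltr_pM2l//.
  by apply: phiA; rewrite (ltW st).
- move=> t x /andP[st _]; rewrite /B -addrA lerDl addr_ge0//.
    by rewrite mulr_ge0 ?w_ge0// ltW.
  by rewrite mulr_ge0 ?(le_trans _ (W_ge t st)) ?(ltW ed0)// (le_trans ler01).
- move=> t x y stT xy; have [st tT] := andP stT.
  have Wphi : e * de * phi x <= W t * phi x.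
    by rewrite ler_wpM2r ?W_ge// (le_trans ler01).
  have ew : 0 <= e * w t x by rewrite mulr_ge0 ?w_ge0// ltW.
  have uM : u t y - u t x <= 2 * M.
    have := HM t y st; have := HM t x st; rewrite !ler_norml.
    by move=> /andP[? ?] /andP[? ?]; lra.
  have pen0 : 0 <= dot (y - x) (y - x) `^ a by exact: powR_ge0.
  (* [phi] is evaluated at [x] only: it settles the case of far [x], and otherwise [y] is far from
     [x] and the penalty decides. *)
  have [xr|xr] := ltP rad1 (enorm x).
    have := Hrad1 x xr; rewrite ltr_pdivrMr// mulrC => H1.
    apply: (@le_trans _ _ 0); first by rewrite /B; lra.
    by rewrite mulr_ge0// (le_trans (ltW pmin0))// Pmin.
  have ell1 : 1 <= ell.
    by rewrite lerDl; apply: divr_ge0; [exact: mulr_ge0 | exact: ltW].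
  have yr : `|rad1| + ell < enorm y.
    case: xy => // H1; have : enorm x <= `|rad1| by rewrite (le_trans xr)// ler_norm.
    by lra.
  have yx : ell <= enorm (y - x).
    have := enormD x (y - x); rewrite addrC subrK.
    by have := ler_norm rad1; lra.
  have n1 : 1 <= enorm (y - x) by exact: le_trans yx.
  have H1 : ell <= dot (y - x) (y - x) `^ a.
    apply: (le_trans yx); apply: (@le_trans _ _ (dot (y - x) (y - x))).
      by rewrite -sqr_enorm expr2 ler_peMr ?enorm_ge0.
    by rewrite le1r_powR// -sqr_enorm exprn_ege1.
  have H2 : pmin * ell <= beta' * expR (2 * a * kappa * (t - s)) * dot (y - x) (y - x) `^ a.
    by rewrite ler_pM ?Pmin// ltW// (lt_le_trans ltr01).
  have H3 : pmin * ell = pmin + 2 * M by rewrite /ell; field; rewrite gt_eqF.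
  have H4 : 0 <= e * de * phi x by rewrite mulr_ge0 ?(ltW ed0)// (le_trans ler01).
  by rewrite /B; lra.
- move=> x y; rewrite /B /W !(sol_init solu) (sol_init solw) subrr mulr0 expR0 mulr1.
  have E : e *: (e^-1 *: (y - x)) = y - x.
    by rewrite scalerA mulfV ?gt_eqF// scale1r.
  have := incr x (e^-1 *: (y - x)); have := scaleE (e^-1 *: (y - x)).
  by rewrite E (addrC x) subrK => ->; lra.
- by rewrite (ltW sT) lexx.
Qed.

(** For fixed [h] and [de], [increment_bound] is divided by e and e tends to 0 from the right; [de]
    is tuned so that the Lyapunov term is the allowed error [ep]. *)
Lemma gradient_linear_bound x h : dot h (grad (u T) x) <=
  w T x + beta * expR (2 * a * kappa * (T - s)) * dot h h `^ a.
Proof.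
have [phi [mu [phi2 mu0 phi1 phioo phiA]]] := lyapunov_ge1 Is (ltW sT).
have E0 : 0 < expR (mu * (T - s)) * phi x.
  by rewrite mulr_gt0 ?expR_gt0// (lt_le_trans ltr01).
apply/ler_addgt0Pr => ep ep0.
pose de := ep / (expR (mu * (T - s)) * phi x).
have de0 : 0 < de by rewrite divr_gt0.
have -> : ep = de * expR (mu * (T - s)) * phi x by rewrite -mulrA divfK// gt_eqF.
have ninc := near_increment_le fb cpsi psi_ge0 phi1 phioo beta_gt0 a_ge1 de0 f_psi.
have u2 := sol_C2 solu sT.
have Q0 : e^-1 * (u T (x + e *: h) - u T x) @[e --> (0 : R)^'+] --> dot h (grad (u T) x).
  have := is_derive_quot (C1_line x h 0 u2.1); rewrite scale0r addr0.
  move=> /cvg_dnbhs_at_right; apply: cvg_trans; apply: near_eq_cvg.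
  by near=> e; rewrite addr0.
rewrite -(cvg_lim _ Q0)//; apply: limr_le.
  by apply/cvg_ex; exists (dot h (grad (u T) x)).
near=> e.
have e0 : 0 < e by near: e; exact: nbhs_right_gt.
rewrite ler_pdivrMl//.
have H : forall x h, f (x + e *: h) - f x <= e * (psi x + de * phi x + beta * dot h h `^ a).
  by near: e.
have := increment_bound phi2 mu0 phi1 phioo phiA de0 e0 H x h.
by rewrite -!addrA (addrC (de * _ * _)).
Unshelve. all: by end_near. Qed.

End GradientBound.

Lemma C1b_Cb (f : 'rV[R]_d -> R) : C1b f -> Cb f.
Proof. by move=> [[cf _] bf _]. Qed.

Lemma grad_powR_Cb (f : 'rV[R]_d -> R) (p : R) : 0 < p -> C1b f ->
  Cb (fun y => enorm (grad f y) `^ p).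
Proof.
move=> p0 fb; have [L L0 HL] := C1b_grad_bound fb; split.
  move=> x; apply: (@cvg_powR_ge0 _ _ (nbhs x) _ (fun y => enorm (grad f y))) => //.
  - by move=> ?; exact: enorm_ge0.
  - exact: enorm_ge0.
  have cg := @continuous_grad _ _ f (C1b_C1 fb) x.
  exact: (cvg_comp _ _ cg (@continuous_enorm _ _ _)).
exists (L `^ p); split; first exact: num_real.
move=> M LM x _ /=; rewrite ger0_norm ?powR_ge0// (le_trans _ (ltW LM))//.
by rewrite ge0_ler_powR ?nnegrE ?enorm_ge0 ?(ltW p0).
Qed.

Section Estimate.
Variables (G : R -> R -> ('rV[R]_d -> R) -> 'rV[R]_d -> R).
Hypothesis G_evol : evolution_operator q b I G.
Variables (m r : R -> 'rV[R]_d -> R) (kappa : R).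
Hypothesis dq_bound : forall t x i j k, I t ->
  pder k (fun y => q t y i j) x ^+ 2 <= m t x * eta t x.
Hypothesis jac_bound : jac_bounded_by I b r.

Lemma gradient_estimate_le2 (p s t : R) f x : 1 < p <= 2 ->
  (forall t x, I t -> r t x + d%:R ^+ 3 * m t x / (4 * (p - 1)) <= kappa) ->
  I s -> s < t -> C1b f ->
  enorm (grad (G t s f) x) `^ p <=
    expR (kappa * (t - s)) `^ p * G t s (fun y => enorm (grad f y) `^ p) x.
Proof.
move=> /andP[p1 p2] kb Is st fb.
have p0 : 0 < p by rewrite (lt_trans ltr01).
have pm : 0 < p - 1 by rewrite subr_gt0.
have Npb := grad_powR_Cb p0 fb.
have [beta beta0 [young legendre]] := young_duality p1.
(* 2 a is the conjugate exponent of [p], so 2 a - 1 = 1 / (p - 1), and p <= 2 yields a >= 1. *)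
pose a := p / (p - 1) / 2.
have a2 : 2 * a = p / (p - 1) by rewrite /a; field; rewrite gt_eqF.
have a1 : 1 <= a by rewrite /a ler_pdivlMr// mul1r ler_pdivlMr//; lra.
have kb' t' x' : I t' -> r t' x' + (2 * a - 1) * (d%:R ^+ 3 * m t' x' / 4) <= kappa.
  move=> It'; rewrite (le_trans _ (kb t' x' It'))// lerD2l a2.
  by rewrite le_eqVlt; apply/orP; left; apply/eqP; field; rewrite gt_eqF.
have dotp (h : 'rV[R]_d) : dot h h `^ a = enorm h `^ (p / (p - 1)).
  by rewrite enorm_powR.
pose N := enorm (grad (G t s f) x).
pose E := expR (kappa * (t - s)).
have E0 : 0 < E by exact: expR_gt0.
have H h : dot h (grad (G t s f) x) <= G t s (fun y => enorm (grad f y) `^ p) x +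
    beta * (E * enorm h) `^ (p / (p - 1)).
  rewrite powRM ?enorm_ge0 ?(ltW E0)// /E -expRM.
  have -> : kappa * (t - s) * (p / (p - 1)) = 2 * a * kappa * (t - s).
    by rewrite a2; ring.
  rewrite -dotp mulrA.
  apply: (@gradient_linear_bound m r a kappa a1 dq_bound jac_bound kb' s t f
    (fun y => enorm (grad f y) `^ p) (fun t => G t s f)
    (fun t => G t s (fun y => enorm (grad f y) `^ p)) beta Is st fb Npb.1) => //.
  - by move=> y; exact: powR_ge0.
  - exact/G_evol/C1b_Cb.
  - exact: G_evol.
  - move=> y k; rewrite dotp (le_trans (dot_enorm _ _))// mulrC.
    by apply: young; exact: enorm_ge0.
have : (N / E) `^ p <= G t s (fun y => enorm (grad f y) `^ p) x.
  apply: legendre => [|z z0]; first by rewrite divr_ge0 ?enorm_ge0// ltW.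
  have [N0|N0] := eqVneq N 0.
    rewrite N0 !mul0r; have := H 0; rewrite dot0l => H0.
    apply: (le_trans H0); rewrite lerD2l ler_pM2l// ge0_ler_powR ?nnegrE//.
    - by rewrite divr_ge0 ?(ltW p0) ?(ltW pm).
    - by rewrite mulr_ge0 ?enorm_ge0// ltW.
    - by rewrite /enorm dot0l sqrtr0 mulr0.
  have Np : 0 < N by rewrite lt_neqAle eq_sym N0 enorm_ge0.
  (* The vector of length z / E along the gradient: the left side becomes (N / E) z and the penalty
     beta z^q, the form that [legendre] expects. *)
  have := H ((z / (E * N)) *: grad (G t s f) x).
  rewrite dotZl -sqr_enorm -/N.
  have -> : enorm ((z / (E * N)) *: grad (G t s f) x) = z / (E * N) * N.
    rewrite /enorm dotZl dotZr mulrA -expr2 sqrtrM ?sqr_ge0// sqrtr_sqr ger0_norm//.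
    by rewrite divr_ge0// mulr_ge0// ltW.
  have -> : z / (E * N) * N ^+ 2 = N / E * z by field; rewrite !gt_eqF.
  by have -> : E * (z / (E * N) * N) = z by field; rewrite !gt_eqF.
have -> : N `^ p = E `^ p * (N / E) `^ p.
  rewrite -powRM ?divr_ge0 ?enorm_ge0 ?(ltW E0)//.
  by rewrite mulrC divfK// gt_eqF.
by move=> H'; rewrite ler_pM2l// powR_gt0.
Qed.

(** For p > 2 the minimum is 1, the value belonging to exponent 2, so the estimate for 2 has the
    same [kappa]. What remains is Jensen's inequality for [G], obtained from [solution_comparison]
    with the tangent of [sqr_le_tangent]. *)
Lemma gradient_estimate_gt1 (p : R) f : 1 < p ->
  (forall t x, I t -> r t x + d%:R ^+ 3 * m t x / (4 * Num.min (p - 1) 1) <= kappa) ->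
  C1b f -> gradient_estimate I G p (p * kappa) f.
Proof.
move=> p1 kb fb s t x Is It; rewrite le_eqVlt => /predU1P[<-|st].
  have p0 : 0 < p by rewrite (lt_trans ltr01).
  have GE g : Cb g -> G s s g = g.
    by move=> gb; apply/funext => y; exact: (sol_init (G_evol Is gb)).
  rewrite !GE; [|exact: grad_powR_Cb|exact: C1b_Cb].
  by rewrite subrr mulr0 expR0 mul1r.
have p0 : 0 < p by rewrite (lt_trans ltr01).
have -> : expR (p * kappa * (t - s)) = expR (kappa * (t - s)) `^ p.
  by rewrite -expRM; congr expR; ring.
have [p2|p2] := leP p 2.
  apply: gradient_estimate_le2 => //; first by rewrite p1.
  by move=> t' x' It'; have := kb t' x' It'; rewrite min_l//; lra.
have kb2 t' x' : I t' -> r t' x' + d%:R ^+ 3 * m t' x' / (4 * (2 - 1)) <= kappa.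
  move=> It'; have := kb t' x' It'; rewrite min_r; last by lra.
  by have -> : (2 - 1 : R) = 1 by ring.
have le2 : 1 < (2 : R) <= 2 by rewrite ltr1n lexx.
have est2 := gradient_estimate_le2 x le2 kb2 Is st fb.
pose E := expR (kappa * (t - s)).
have E0 : 0 < E by exact: expR_gt0.
pose N := enorm (grad (G t s f) x).
have N0 : 0 <= N by exact: enorm_ge0.
pose w := G t s (fun y => enorm (grad f y) `^ p) x.
have pb := grad_powR_Cb p0 fb.
have b2 := grad_powR_Cb (ltr0n R 2) fb.
have w0 : 0 <= w.
  have := @solution_comparison s t _ _ _ _ 0 1 0
    Is (ltW st) (G_evol Is pb) (G_evol Is pb) _ x.
  by rewrite mul0r mul1r addr0; apply => y; rewrite mul0r mul1r addr0 powR_ge0.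
apply/ler_addgt0Pr => e e0.
have Ep0 : 0 < E `^ p by rewrite powR_gt0.
(* The added term makes the tangency point positive even if w = 0, and costs exactly [e] after
   multiplication by E^p. *)
pose v := w + e / E `^ p.
have v0 : 0 < v by rewrite ltr_wpDl// divr_gt0.
pose z := v `^ p^-1.
have z0 : 0 < z by rewrite powR_gt0.
have zp : z `^ p = v by rewrite -powRrM mulVf ?gt_eqF// powRr1 ?(ltW v0).
(* Since w <= z^p, the tangent at [z] evaluated at [w] is at most z^2. *)
have comp : G t s (fun y => enorm (grad f y) `^ 2) x <= z ^+ 2.
  have := @solution_comparison s t _ _ _ _
    1 (2 / p * (z ^+ 2 / z `^ p)) ((1 - 2 / p) * z ^+ 2)
    Is (ltW st) (G_evol Is b2) (G_evol Is pb) _ x.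
  rewrite mul1r => H; apply: le_trans (H _) _.
    by move=> y; rewrite mul1r; apply: sqr_le_tangent => //; exact: enorm_ge0.
  rewrite -/w zp.
  have : 2 / p * (z ^+ 2 / v) * w <= 2 / p * z ^+ 2.
    rewrite -mulrA ler_pM2l ?divr_gt0// mulrAC ler_pdivrMr// ler_pM2l ?exprn_gt0//.
    by rewrite lerDl divr_ge0 ?(ltW e0) ?(ltW Ep0).
  by rewrite mulrBl mul1r; lra.
have NEz : N <= E * z.
  rewrite -(@ler_pXn2r _ 2) ?nnegrE ?mulr_ge0 ?(ltW E0) ?(ltW z0)//.
  rewrite exprMn -!powR_mulrn ?(ltW E0) ?(ltW z0)// (le_trans est2)//.
  by rewrite ler_pM2l ?powR_gt0// powR_mulrn// ltW.
have : N `^ p <= (E * z) `^ p.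
  by rewrite ge0_ler_powR ?nnegrE ?mulr_ge0 ?(ltW E0) ?(ltW z0) ?(ltW p0).
rewrite powRM ?(ltW E0) ?(ltW z0)// zp /v mulrDr.
by have -> : E `^ p * (e / E `^ p) = e by field; rewrite gt_eqF.
Qed.

End Estimate.

(** With m = 0 the constant is [k0] for every p > 1. For p = 1 + e, |grad f|^p <= (L + 1)^e |grad
    f|, and comparison moves the factor (L + 1)^e outside [G]; the limit in e then concerns real
    numbers only. The 1 in L + 1 keeps the base positive. *)
Lemma gradient_estimate_one G (k0 : R) f : evolution_operator q b I G ->
  (forall t x i j k, I t -> pder k (fun y => q t y i j) x = 0) ->
  jac_bounded_by I b (fun _ _ => k0) -> C1b f -> gradient_estimate I G 1 k0 f.
Proof.
move=> G_evol dq0 jb fb s t x Is It st.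
rewrite powRr1 ?enorm_ge0//.
have -> : (fun y => enorm (grad f y) `^ 1) = (fun y => enorm (grad f y)).
  by apply/funext => y; rewrite powRr1// enorm_ge0.
set w := G t s _ x.
have est p : 1 < p -> enorm (grad (G t s f) x) `^ p <=
    expR (p * k0 * (t - s)) * G t s (fun y => enorm (grad f y) `^ p) x.
  move=> p1.
  apply: (@gradient_estimate_gt1 G G_evol (fun _ _ => 0) (fun _ _ => k0) k0) => //.
    by move=> t' x' i j k It'; rewrite dq0// expr0n/= mul0r.
  by move=> t' x' It'; rewrite mulr0 mul0r addr0.
have b1 : Cb (fun y => enorm (grad f y)).
  have -> : (fun y => enorm (grad f y)) = (fun y => enorm (grad f y) `^ 1).
    by apply/funext => y; rewrite powRr1// enorm_ge0.
  exact: grad_powR_Cb.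
have [L L0 HL] := C1b_grad_bound fb.
have L1 : 0 < L + 1 by rewrite ltr_wpDl.
pose E := expR (k0 * (t - s)).
have E0 : 0 < E by exact: expR_gt0.
have w0 : 0 <= w.
  have := @solution_comparison s t _ _ _ _ 0 1 0
    Is st (G_evol _ _ Is b1) (G_evol _ _ Is b1) _ x.
  by rewrite mul0r mul1r addr0; apply => y; rewrite mul0r mul1r addr0 enorm_ge0.
have [N0|N0] := eqVneq (enorm (grad (G t s f) x)) 0.
  by rewrite N0 mulr_ge0// ltW.
have Np : 0 < enorm (grad (G t s f) x) by rewrite lt_neqAle eq_sym N0 enorm_ge0.
apply: (@powR_limit_one _ _ (E * (L + 1))) => //; first by rewrite mulr_gt0.
move=> e /andP[e0 e1].
have p1 : 1 < 1 + e by rewrite ltrDl.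
have pb := grad_powR_Cb (lt_trans ltr01 p1) fb.
have powS y : 0 <= y -> y `^ (1 + e) = y * y `^ e.
  by move=> y0; rewrite -(mulr_powRB1 y0 (lt_trans ltr01 p1)) (addrC 1) addrK.
have := est _ p1; rewrite powS ?enorm_ge0// => /le_trans; apply.
have -> : expR ((1 + e) * k0 * (t - s)) = E * E `^ e.
  by rewrite -powS ?(ltW E0)// /E -expRM; congr expR; ring.
rewrite powRM ?(ltW E0) ?(ltW L1)//.
have -> : E `^ e * (L + 1) `^ e * (E * w) = E * E `^ e * ((L + 1) `^ e * w + 0) by ring.
rewrite ler_pM2l ?mulr_gt0 ?powR_gt0// -[leLHS]mul1r.
apply: (solution_comparison Is st (G_evol _ _ Is pb) (G_evol _ _ Is b1)) => y.
rewrite mul1r addr0 powS ?enorm_ge0// mulrC ler_wpM2r ?enorm_ge0//.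
rewrite ge0_ler_powR ?nnegrE ?enorm_ge0 ?(ltW e0) ?(ltW L1)//.
by rewrite (le_trans (HL y))// lerDl.
Qed.

End Evolution.

(** The hypotheses on the diffusion are instances of |D_k q_ij|^2 <= m eta: m = rho^2 eta in (a), m
    = rho0^2 in (b) and m = 0 in (c). *)
Theorem theorem4p5 (R : realType) (d : nat) (I : set R) (alpha : R)
    (q : R -> 'rV[R]_d -> 'M[R]_d) (b : R -> 'rV[R]_d -> 'rV[R]_d)
    (eta : R -> 'rV[R]_d -> R)
    (G : R -> R -> ('rV[R]_d -> R) -> 'rV[R]_d -> R)
    (d_ge1 : (1 <= d)%N) (I_halfline : R_or_right_halfline I)
    (alpha01 : 0 < alpha < 1)
    (coef_reg : regular_coefficients q b I alpha)
    (ellipt : uniformly_elliptic q I eta)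
    (lyap : has_lyapunov q b I)
    (G_evol : evolution_operator q b I G) :
  (forall (rho : R -> R) (r : R -> 'rV[R]_d -> R) (p0 : R),
     let S := [set r z.1 z.2
                 + d%:R ^+ 3 * rho z.1 ^+ 2 * eta z.1 z.2
                   / (4 * Num.min (p0 - 1) 1) | z in I `*` setT] in
     {within I, continuous rho} ->
     (forall t, I t -> 0 <= rho t) ->
     (forall t x i j k, I t ->
        `|pder k (fun y => q t y i j) x| <= rho t * eta t x) ->
     1 < p0 ->
     jac_bounded_by I b r ->
     has_ubound S ->
     forall p f, p0 <= p -> C1b f -> gradient_estimate I G p (p * sup S) f)
  /\
  (forall k0 rho0 : R,
     jac_bounded_by I b (fun _ _ => k0) ->
     0 < rho0 ->
     (forall t x i j k, I t ->
        `|pder k (fun y => q t y i j) x| <= rho0 * Num.sqrt (eta t x)) ->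
     (forall p f, 1 < p -> C1b f ->
        gradient_estimate I G p
          (p * (k0 + d%:R ^+ 3 * rho0 ^+ 2 / (4 * Num.min (p - 1) 1))) f)
     /\
     ((forall t x y, I t -> q t x = q t y) ->
      forall r : R -> 'rV[R]_d -> R,
      jac_bounded_by I b r ->
      (forall t x, I t -> r t x <= eta t x) ->
      forall f, C1b f -> gradient_estimate I G 1 k0 f)).
Proof.
split.
- move=> rho r p0 S _ rho0 dq p01 jb ubS p f p0p fb.
  have m0 : 0 < Num.min (p0 - 1) 1 by rewrite lt_min subr_gt0 p01 ltr01.
  have mp : Num.min (p0 - 1) 1 <= Num.min (p - 1) 1.
    by rewrite le_min !ge_min lexx orbT andbT lerD2r p0p.
  apply: (gradient_estimate_gt1 I_halfline alpha01 coef_reg ellipt lyap G_evol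
    (m := fun t x => rho t ^+ 2 * eta t x) (r := r)) => //.
  + move=> t x i j k It; rewrite -mulrA -expr2 -exprMn -real_normK ?num_real//.
    by rewrite lerXn2r ?nnegrE ?dq// mulr_ge0 ?rho0// ltW// (elliptic_gt0 ellipt).
  + exact: lt_le_trans p01 p0p.
  (* As rho^2 eta >= 0, replacing [p0] by the larger [p] can only lower the quotient. *)
  move=> t x It; apply: (@le_trans _ _ (r t x + d%:R ^+ 3 * rho t ^+ 2 * eta t x
                   / (4 * Num.min (p0 - 1) 1))).
    rewrite lerD2l !mulrA ler_wpM2l//.
      by rewrite !mulr_ge0 ?exprn_ge0 ?ler0n ?rho0// ltW// (elliptic_gt0 ellipt).
    by rewrite lef_pV2 ?posrE ?mulr_gt0// ?ler_pM2l// (lt_le_trans m0).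
  by apply: ub_le_sup => //; exists (t, x).
- move=> k0 rho0 jb rho00 dq; split.
    move=> p f p1 fb.
    apply: (gradient_estimate_gt1 I_halfline alpha01 coef_reg ellipt lyap G_evol
      (m := fun _ _ => rho0 ^+ 2) (r := fun _ _ => k0)) => //.
    move=> t x i j k It; have e0 := elliptic_gt0 ellipt x It.
    rewrite -[X in _ * X]sqr_sqrtr ?(ltW e0)// -exprMn -real_normK ?num_real//.
    by rewrite lerXn2r ?nnegrE ?dq// mulr_ge0 ?sqrtr_ge0// ltW.
  move=> qcst r _ _ f fb.
  apply: (gradient_estimate_one I_halfline alpha01 coef_reg ellipt lyap G_evol) => //.
  move=> t x i j k It.
  have -> : (fun y => q t y i j) = (fun=> q t x i j).
    by apply/funext => y; rewrite (qcst t y x It).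
  by rewrite pder_cst.
Qed.
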